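(* Let $(M,J)$ be an almost complex manifold. Then: (i) If $\nabla$ is a complex connection on $M$ whose torsion is of type $(1,1)$ with respect to $J$, then $J$ is integrable. (ii) If $\nabla$ is a complex connection on $M$ whose torsion is of type $(2,0)$ with respect to $J$, then $J$ is integrable. (iii) If $\nabla$ is a complex connection on $M$ whose torsion $T$ is of type $(2,0)+(0,2)$ with respect to $J$ and $J$ is integrable, then $T$ is of type $(2,0)$. (iv) If $J$ is integrable, then there exists a complex connection $\nabla$ on $M$ whose torsion is of type $(1,1)$ with respect to $J$. (v) If $J$ is integrable, then there exists a complex connection $\nabla$ on $M$ whose torsion is of type $(2,0)$ with respect to $J$.
   Context: An almost complex structure $J$ on $M$ is integrable if its Nijenhuis tensor $N(X,Y)=[JX,JY]-J[X,JY]-J[JX,Y]-[X,Y]$ vanishes identically. A complex connection on $(M,J)$ is an affine connection $\nabla$ on $M$ (i.e. on $TM$) with $\nabla J=0$, i.e. $\nabla_X(JY)=J\nabla_XY$ for all vector fields $X,Y$. The torsion of $\nabla$ is $T(X,Y)=\nabla_XY-\nabla_YX-[X,Y]$. The torsion $T$ is said to be, with respect to $J$: of type $(1,1)$ if $T(JX,JY)=T(X,Y)$; of type $(2,0)$ if $T(JX,Y)=JT(X,Y)$; of type $(2,0)+(0,2)$ if $T(JX,JY)=-T(X,Y)$; in each case for all vector fields $X,Y$ on $M$. *)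

(* Defs.v *)
From HB Require Import structures.
From mathcomp Require Import all_boot all_order all_algebra.
From mathcomp Require Import boolp classical_sets functions cardinality reals.
From mathcomp Require Import topology normedtype landau derive.
From mathcomp Require Import ring.

Set Implicit Arguments.
Unset Strict Implicit.
Unset Printing Implicit Defensive.

Import Order.TTheory GRing.Theory Num.Theory.
Import numFieldNormedType.Exports.

Local Open Scope classical_set_scope.
Local Open Scope ring_scope.

(* Ck k U f: f is of class C^k at every point of U, to be used with U open.   *)
(* On the differentiability domain 'D_v f x = 'd f x v, so the recursive      *)
(* clause says that f is differentiable on U with a differential of class     *)
(* C^(k-1). The values of f outside U are irrelevant (Ck_ext).                *)
Fixpoint Ck (R : realType) (V W : normedModType R) (k : nat) (U : set V)
    (f : V -> W) : Prop :=
  if k is k'.+1 then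
    (forall x, U x -> differentiable f x) /\ (forall v, Ck k' U ('D_v f))
  else forall x, U x -> {for x, continuous f}.

Definition smooth_on (R : realType) (V W : normedModType R) (U : set V)
  (f : V -> W) : Prop := forall k, Ck k U f.

Section SmoothOn.
Variables (R : realType) (V : normedModType R).
Implicit Types (U : set V) (k : nat).

Lemma near_eq_differentiable (W : normedModType R) (f g : V -> W) (x : V) :
  {near x, f =1 g} -> differentiable f x -> differentiable g x.
Proof.
move=> fg /diff_locallyP[cdf df].
have fgx : f x = g x by exact: (nbhs_singleton fg).
have dg : g \o shift x = cst (g x) + 'd f x +o_ 0 id.
  apply/eqaddoP => e e0; move/eqaddoP: df => /(_ e e0) df.
  have fg0 : \forall h \near (0 : V), f (h + x) = g (h + x).
    by have := fg; rewrite (near_shift 0) /= subr0.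
  near=> h.
  have -> : ((g \o shift x) - (cst (g x) + 'd f x)) h =
            ((f \o shift x) - (cst (f x) + 'd f x)) h.
    rewrite /= !fctE /= fgx; congr (_ - _).
    by apply/esym; near: h.
  by near: h.
have dgE : 'd g x = 'd f x :> (V -> W) by apply: diff_unique.
by apply/diff_locallyP; rewrite dgE.
Unshelve. all: by end_near. Qed.


Lemma Ck_ext (W : normedModType R) k U (f g : V -> W) :
  open U -> {in U, f =1 g} -> Ck k U f -> Ck k U g.
Proof.
move=> oU; elim: k f g => [|k IH] f g fg /=.
  move=> cf x Ux; have fgx : {near x, f =1 g}.
    by apply: filterS (open_nbhs_nbhs (conj oU Ux)) => y Uy; apply/fg/mem_set.
  rewrite /prop_for /continuous_at -(nbhs_singleton fgx).
  by apply: cvg_trans (cf x Ux); apply: near_eq_cvg.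
case=> df cf; split=> [x Ux|v].
  apply: near_eq_differentiable (df x Ux).
  by apply: filterS (open_nbhs_nbhs (conj oU Ux)) => y Uy; apply/fg/mem_set.
apply: IH (cf v) => x /set_mem Ux; apply: near_eq_derive.
by apply: filterS (open_nbhs_nbhs (conj oU Ux)) => y Uy; apply/fg/mem_set.
Qed.

Lemma CkS (W : normedModType R) k U (f : V -> W) : Ck k.+1 U f -> Ck k U f.
Proof.
elim: k f => [|k IH] f /= [df cf].
  by move=> x /df; apply: differentiable_continuous.
by split=> // v; apply: IH.
Qed.

Lemma Ck_cst (W : normedModType R) k U (c : W) : Ck k U (cst c : V -> W).
Proof.
elim: k c => [|k IH] c /=; first by move=> x _; apply: cst_continuous.
split=> [x _|v]; first exact: differentiable_cst.
by have -> : 'D_v (cst c : V -> W) = cst 0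
  by apply/funext => x; rewrite derive_cst.
Qed.

Lemma CkD (W : normedModType R) k U (f g : V -> W) : open U ->
  Ck k U f -> Ck k U g -> Ck k U (f + g).
Proof.
move=> oU; elim: k f g => [|k IH] f g /=.
  by move=> cf cg x Ux; apply: continuousD; [exact: cf|exact: cg].
move=> [df cf] [dg cg]; split=> [x Ux|v].
  by apply: differentiableD; [exact: df|exact: dg].
apply: (@Ck_ext _ _ _ ('D_v f + 'D_v g)) => //; last exact: IH.
move=> x /set_mem Ux; rewrite deriveD //; apply: diff_derivable.
- exact: df.
- exact: dg.
Qed.

Lemma CkM k U (f g : V -> R) : open U ->
  Ck k U f -> Ck k U g -> Ck k U (f * g).
Proof.
move=> oU; elim: k f g => [|k IH] f g.
  by move=> cf cg x Ux; exact: (continuousM (cf x Ux) (cg x Ux)).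
move=> Cf Cg; have [df cf] := Cf; have [dg cg] := Cg; split=> [x Ux|v].
  by apply: differentiableM; [exact: df|exact: dg].
apply: (@Ck_ext _ _ _ (f * 'D_v g + g * 'D_v f)) => //.
  move=> x /set_mem Ux; rewrite deriveM //; apply: diff_derivable.
  - exact: df.
  - exact: dg.
by apply: CkD => //; apply: IH; [exact: CkS|exact: cg|exact: CkS|exact: cf].
Qed.

End SmoothOn.

(* A homeomorphism from an open set of M onto an open set of R^n. The map and *)
(* its inverse are total functions, only meaningful on dom and cod.           *)
Record chart (R : realType) (n : nat) (M : topologicalType) := Chart {
  dom : set M;
  cod : set 'rV[R]_n;
  coord : M -> 'rV[R]_n;
  param : 'rV[R]_n -> M;
  dom_open : open dom;
  cod_open : open cod;
  coord_cod : forall p, dom p -> cod (coord p);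
  param_dom : forall x, cod x -> dom (param x);
  coordK : forall p, dom p -> param (coord p) = p;
  paramK : forall x, cod x -> coord (param x) = x;
  coord_continuous : forall p, dom p -> {for p, continuous coord};
  param_continuous : forall x, cod x -> {for x, continuous param}
}.

(* The smooth structure is the one generated by the atlas, which need not be  *)
(* maximal.                                                                   *)
Record manifold (R : realType) (n : nat) := Manifold {
  points :> topologicalType;
  atlas : set (chart R n points);
  manifold_hausdorff : hausdorff_space points;
  manifold_second_countable : @second_countable points;
  atlas_cover : forall p : points, exists2 c, atlas c & dom c p;
  atlas_compatible : forall c d, atlas c -> atlas d ->
    smooth_on (cod c `&` param c @^-1` dom d) (coord d \o param c)
}.

Section SmoothFunctions.
Variables (R : realType) (n : nat) (M : manifold R n).

Definition smooth (f : M -> R) : Prop :=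
  forall c, atlas c -> smooth_on (cod c) (f \o param c).

Lemma smooth_cst (a : R) : smooth (cst a).
Proof. by move=> c _ k; apply: Ck_cst. Qed.

Lemma smoothD (f g : M -> R) : smooth f -> smooth g -> smooth (f + g).
Proof.
by move=> sf sg c Ac k; apply: CkD; [exact: cod_open|exact: sf|exact: sg].
Qed.

Lemma smoothM (f g : M -> R) : smooth f -> smooth g -> smooth (f * g).
Proof.
by move=> sf sg c Ac k; apply: CkM; [exact: cod_open|exact: sf|exact: sg].
Qed.

Lemma smoothN (f : M -> R) : smooth f -> smooth (- f).
Proof.
move=> sf; have -> : - f = cst (-1) * f.
  by apply/funext => p; rewrite /GRing.mul /= mulN1r.
by apply: smoothM => //; exact: smooth_cst.
Qed.

Definition smooth_pred : {pred M -> R} := fun f => `[< smooth f >].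

Lemma smooth_subring : subring_closed smooth_pred.
Proof.
split=> [|f g /asboolP sf /asboolP sg|f g /asboolP sf /asboolP sg].
- by apply/asboolP; exact: smooth_cst.
- by apply/asboolP; apply: smoothD => //; exact: smoothN.
- by apply/asboolP; exact: smoothM.
Qed.

HB.instance Definition _ :=
  GRing.isSubringClosed.Build (M -> R) smooth_pred smooth_subring.

Record smooth_function := SmoothFunction {
  smooth_val :> M -> R;
  smooth_valP : smooth_val \in smooth_pred
}.

HB.instance Definition _ := [isSub for smooth_val].
HB.instance Definition _ := [Choice of smooth_function by <:].
HB.instance Definition _ :=
  GRing.SubChoice_isSubComPzRing.Build (M -> R) smooth_pred smooth_function
    smooth_subring.

Lemma smooth_functionP (f : smooth_function) : smooth f.
Proof. exact/asboolP/smooth_valP. Qed.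

Definition mk_smooth (f : M -> R) (sf : smooth f) : smooth_function :=
  SmoothFunction (asboolT sf).

Definition smooth_const (a : R) : smooth_function := mk_smooth (smooth_cst a).

End SmoothFunctions.

Arguments mk_smooth {R n M f}.

Section Tangent.
Variables (R : realType) (n : nat) (M : manifold R n).
Local Notation Coo := (smooth_function M).

(* The derivations at p of the algebra of smooth functions, i.e., the         *)
(* tangent vectors at p.                                                      *)
Definition derivation_at (p : M) (v : Coo -> R) : Prop :=
  [/\ forall f g, v (f + g) = v f + v g,
      forall a f, v (smooth_const M a * f) = a * v f
    & forall f g, v (f * g) = v f * g p + f p * v g].

Definition derivation_pred (p : M) : {pred Coo -> R} :=
  fun v => `[< derivation_at p v >].

Lemma derivation_submod p : submod_closed (derivation_pred p).
Proof.
split=> [|a v w /asboolP[vD vZ vM] /asboolP[wD wZ wM]]; apply/asboolP.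
  split=> *; rewrite /GRing.zero /=.
  - by rewrite addr0.
  - by rewrite mulr0.
  - by rewrite mul0r mulr0 addr0.
have E f : (a *: v + w) f = a * v f + w f by [].
split=> [f g|b f|f g]; rewrite !E.
- by rewrite vD wD mulrDr addrACA.
- by rewrite vZ wZ mulrDr mulrCA.
- by rewrite vM wM !mulrDr mulrDl addrACA mulrA [f p * (a * _)]mulrCA.
Qed.

Record tangent (p : M) := Tangent {
  tangent_val :> Coo -> R;
  tangent_valP : tangent_val \in derivation_pred p
}.

HB.instance Definition _ p := [isSub for @tangent_val p].
HB.instance Definition _ p := [Choice of tangent p by <:].
HB.instance Definition _ p :=
  GRing.SubChoice_isSubLmodule.Build R (Coo -> R) (derivation_pred p)
    (tangent p) (derivation_submod p).

Lemma tangentP p (v : tangent p) : derivation_at p v.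
Proof. exact/asboolP/tangent_valP. Qed.

Definition mk_tangent p (v : Coo -> R) (dv : derivation_at p v) : tangent p :=
  Tangent (asboolT dv).

Lemma tangent0E p f : (0 : tangent p) f = 0.
Proof. by rewrite -[tangent_val _]/(val _) (raddf0 val). Qed.

Lemma tangentNE p (v : tangent p) f : (- v) f = - v f.
Proof. by rewrite -[tangent_val (- v)]/(val _) (raddfN val). Qed.

Lemma tangentDE p (v w : tangent p) f : (v + w) f = v f + w f.
Proof. by rewrite -[tangent_val (v + w)]/(val _) (raddfD val). Qed.

Lemma tangentZE p (a : R) (v : tangent p) f : (a *: v) f = a * v f.
Proof. by rewrite -[tangent_val (a *: v)]/(val _) linearZ. Qed.

Record vector_field := VectorField {
  vf_at :> forall p, tangent p;
  vf_smooth : forall f : Coo, smooth (fun p => vf_at p f)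
}.

(* The derivative X f of a smooth function f along X.                         *)
Definition vf_app (X : vector_field) (f : Coo) : Coo := mk_smooth (vf_smooth X f).

Lemma vector_fieldP (X Y : vector_field) : (forall p f, X p f = Y p f) -> X = Y.
Proof.
case: X Y => [X sX] [Y sY] /= XY.
have {}XY : X = Y.
  by apply/functional_extensionality_dep => p; apply/val_inj/funext => f; exact: XY.
by case: _ / XY sY => sY; congr VectorField; exact: Prop_irrelevance.
Qed.

HB.instance Definition _ := gen_eqMixin vector_field.
HB.instance Definition _ := gen_choiceMixin vector_field.

Lemma vf_zero_smooth (f : Coo) : smooth (fun p => (0 : tangent p) f).
Proof.
by under eq_fun do rewrite tangent0E; exact: smooth_cst.
Qed.

Lemma vf_opp_smooth (X : vector_field) (f : Coo) :
  smooth (fun p => (- X p) f).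
Proof.
by under eq_fun do rewrite tangentNE; exact: smoothN (vf_smooth X f).
Qed.

Lemma vf_add_smooth (X Y : vector_field) (f : Coo) :
  smooth (fun p => (X p + Y p) f).
Proof.
under eq_fun do rewrite tangentDE.
exact: smoothD (vf_smooth X f) (vf_smooth Y f).
Qed.

Lemma vf_scale_smooth (g : Coo) (X : vector_field) (f : Coo) :
  smooth (fun p => (g p *: X p) f).
Proof.
under eq_fun do rewrite tangentZE.
exact: smoothM (smooth_functionP g) (vf_smooth X f).
Qed.

Definition vf_zero := VectorField vf_zero_smooth.
Definition vf_opp X := VectorField (vf_opp_smooth X).
Definition vf_add X Y := VectorField (vf_add_smooth X Y).
Definition vf_scale g X := VectorField (vf_scale_smooth g X).

Lemma vf_addA : associative vf_add.
Proof. by move=> X Y Z; apply: vector_fieldP => p f /=; rewrite addrA. Qed.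

Lemma vf_addC : commutative vf_add.
Proof. by move=> X Y; apply: vector_fieldP => p f /=; rewrite addrC. Qed.

Lemma vf_add0 : left_id vf_zero vf_add.
Proof. by move=> X; apply: vector_fieldP => p f /=; rewrite add0r. Qed.

Lemma vf_addN : left_inverse vf_zero vf_opp vf_add.
Proof. by move=> X; apply: vector_fieldP => p f /=; rewrite addNr. Qed.

HB.instance Definition _ :=
  GRing.isZmodule.Build vector_field vf_addA vf_addC vf_add0 vf_addN.

Lemma vf_scaleA (g h : Coo) X : vf_scale g (vf_scale h X) = vf_scale (g * h) X.
Proof. by apply: vector_fieldP => p f /=; rewrite scalerA. Qed.

Lemma vf_scale1 : left_id 1 vf_scale.
Proof. by move=> X; apply: vector_fieldP => p f /=; rewrite scale1r. Qed.

Lemma vf_scaleDr : right_distributive vf_scale +%R.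
Proof. by move=> g X Y; apply: vector_fieldP => p f /=; rewrite scalerDr. Qed.

Lemma vf_scaleDl X : {morph vf_scale^~ X : g h / g + h}.
Proof. by move=> g h; apply: vector_fieldP => p f /=; rewrite scalerDl. Qed.

HB.instance Definition _ :=
  GRing.Zmodule_isLmodule.Build Coo vector_field
    vf_scaleA vf_scale1 vf_scaleDr vf_scaleDl.

Lemma lie_bracket_derivation (X Y : vector_field) (p : M) :
  derivation_at p (fun f => X p (vf_app Y f) - Y p (vf_app X f)).
Proof.
have appD Z f g : vf_app Z (f + g) = vf_app Z f + vf_app Z g.
  by apply/val_inj/funext => q /=; have [-> _ _] := tangentP (Z q).
have appZ Z a f : vf_app Z (smooth_const M a * f) = smooth_const M a * vf_app Z f.
  by apply/val_inj/funext => q /=; have [_ -> _] := tangentP (Z q).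
have appM Z f g : vf_app Z (f * g) = vf_app Z f * g + f * vf_app Z g.
  by apply/val_inj/funext => q /=; have [_ _ ->] := tangentP (Z q).
have [XD XZ XM] := tangentP (X p); have [YD YZ YM] := tangentP (Y p).
split=> [f g|a f|f g].
- by rewrite !appD XD YD opprD addrACA.
- by rewrite !appZ XZ YZ mulrBr.
- by rewrite !appM XD YD !XM !YM /=; ring.
Qed.

Lemma lie_bracket_smooth (X Y : vector_field) (f : Coo) :
  smooth (fun p => mk_tangent (lie_bracket_derivation X Y p) f).
Proof.
exact: smoothD (vf_smooth X (vf_app Y f)) (smoothN (vf_smooth Y (vf_app X f))).
Qed.

Definition lie_bracket (X Y : vector_field) : vector_field :=
  VectorField (lie_bracket_smooth X Y).

End Tangent.

Section AlmostComplex.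
Variables (R : realType) (n : nat) (M : manifold R n).
Local Notation Coo := (smooth_function M).
Local Notation VF := (vector_field M).

(* Smoothness of the field of endomorphisms J is expressed by its action on   *)
(* smooth vector fields.                                                      *)
Record almost_complex_structure := AlmostComplexStructure {
  acs_at :> forall p : M, {linear tangent p -> tangent p};
  acs_sqr : forall (p : M) (v : tangent p), acs_at p (acs_at p v) = - v;
  acs_smooth : forall (X : VF) (f : Coo), smooth (fun p => acs_at p (X p) f)
}.

Definition acs_app (J : almost_complex_structure) (X : VF) : VF :=
  VectorField (acs_smooth J X).

Definition nijenhuis (J : almost_complex_structure) (X Y : VF) : VF :=
  let j := acs_app J in
  lie_bracket (j X) (j Y) - j (lie_bracket X (j Y)) - j (lie_bracket (j X) Y)
  - lie_bracket X Y.

Definition integrable (J : almost_complex_structure) : Prop :=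
  forall X Y, nijenhuis J X Y = 0.

(* R-linearity in the second variable follows from the Leibniz rule applied   *)
(* to constant functions.                                                     *)
Record affine_connection := AffineConnection {
  nabla :> VF -> VF -> VF;
  nabla_linearl : forall (f : Coo) (X Y Z : VF),
    nabla (f *: X + Y) Z = f *: nabla X Z + nabla Y Z;
  nabla_addr : forall X Y Z : VF, nabla X (Y + Z) = nabla X Y + nabla X Z;
  nabla_leibniz : forall (f : Coo) (X Y : VF),
    nabla X (f *: Y) = vf_app X f *: Y + f *: nabla X Y
}.

Definition complex_connection (J : almost_complex_structure)
    (D : affine_connection) : Prop :=
  forall X Y, D X (acs_app J Y) = acs_app J (D X Y).

Definition torsion (D : affine_connection) (X Y : VF) : VF :=
  D X Y - D Y X - lie_bracket X Y.

Definition torsion_type_11 (J : almost_complex_structure)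
    (D : affine_connection) : Prop :=
  forall X Y, torsion D (acs_app J X) (acs_app J Y) = torsion D X Y.

Definition torsion_type_20 (J : almost_complex_structure)
    (D : affine_connection) : Prop :=
  forall X Y, torsion D (acs_app J X) Y = acs_app J (torsion D X Y).

Definition torsion_type_20_02 (J : almost_complex_structure)
    (D : affine_connection) : Prop :=
  forall X Y, torsion D (acs_app J X) (acs_app J Y) = - torsion D X Y.

End AlmostComplex.

(* Main.v *)
From HB Require Import structures.
From Pilot Require Import Defs.
From mathcomp Require Import all_boot all_order all_algebra reals.
From mathcomp Require Import all_classical all_analysis.
From mathcomp Require Import ring lra.

(** Writing [[X, Y] = D_X Y - D_Y X - T(X, Y)] for a complex connection [D]
    turns the Nijenhuis tensor into
      [N(X, Y) = T(X, Y) + J T(X, JY) + J T(JX, Y) - T(JX, JY)]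
    ([nijenhuis_torsion]), since [J] passes through [D] and all the covariant
    derivatives cancel. Parts (i), (ii) and (iii) are then linear algebra on
    [T].

    For the converse parts (iv) and (v) a single connection serves: when [J] is
    integrable there is a complex connection without torsion. It is obtained by
    starting from any affine connection, symmetrising it to remove the torsion
    ([sym_connection]), and correcting it by a tensor built from the covariant
    derivative of [J] ([complex_connection_of]); the corrected connection is
    complex and its torsion is a quarter of [N].

    What remains is that a manifold carries an affine connection. If functions
    [f_i] and vector fields [E_i], locally finite in number, satisfy
    [Y = sum_i Y(f_i) E_i] for every tangent vector [Y], then
    [D_X Y = sum_i X(Y(f_i)) E_i] is a connection: its Leibniz rule is that of
    [X] acting on [h Y(f_i)]. Around a point, coordinates [x_j] and coordinate
    fields, both multiplied by bump functions, give such a family with a cutoff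
    [phi] on the left, [phi Y = sum_j Y(f_j) E_j] ([local_frame]). As tangent
    vectors are derivations of the algebra of global smooth functions, this
    rests on the Hadamard lemma ([hadamard]), whose quotients are integrals
    along segments.

    Countably many cutoffs [phi_k] suffice for each point to have a
    neighbourhood on which some [phi_k] is 1 ([countable_frames]). The local
    families are then combined with the weights [prod_(i < k) (1 - phi_i)]: on
    a set where [phi_k = 1] all the later weights vanish, and
    [sum_k phi_k prod_(i < k) (1 - phi_i)] telescopes to 1: these
    products form a locally finite partition of unity. *)

Set Implicit Arguments.
Unset Strict Implicit.
Unset Printing Implicit Defensive.

Import Order.TTheory GRing.Theory Num.Theory.
Import numFieldNormedType.Exports.

Local Open Scope classical_set_scope.
Local Open Scope ring_scope.

(** * Functions of class C^k *)

(** Exhibiting the differential through an explicit estimate, for use where it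
    is known in advance: an integral for radial means, zero for flat
    functions. *)
Lemma differentiable_of_bound (R : realType) (V W : normedModType R)
    (f : V -> W) (L : {linear V -> W}) (x : V) : continuous L ->
  (forall e, 0 < e ->
     \forall w \near (0 : V), `|f (w + x) - (f x + L w)| <= e * `|w|) ->
  differentiable f x /\ 'd f x = L :> (V -> W).
Proof.
move=> cL bf.
have o : f \o shift x = cst (f x) + L +o_ 0 id.
  by apply/eqaddoP => e e0; exact: bf.
have dE : 'd f x = L :> (V -> W) by exact: diff_unique.
by split=> //; apply/diff_locallyP; rewrite dE.
Qed.

Section CkCalculus.
Variables (R : realType) (V : normedModType R).
Implicit Types (U : set V) (k : nat).

Lemma Ck_local (W : normedModType R) k U (f : V -> W) :
  (forall x, U x -> exists2 U' : set V, U' x & Ck k U' f) -> Ck k U f.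
Proof.
elim: k f => [|k IH] f loc /=.
  move=> x Ux; have [U' U'x cf] := loc x Ux; exact: cf.
split=> [x /loc[U' U'x [df _]]|v]; first exact: df.
by apply: IH => x /loc[U' U'x [_ cf]]; exists U' => //; exact: cf.
Qed.

Lemma Ck_subset (W : normedModType R) k U U' (f : V -> W) :
  U' `<=` U -> Ck k U f -> Ck k U' f.
Proof. by move=> sU cf; apply: Ck_local => x /sU Ux; exists U. Qed.

Lemma smooth_on_subset (W : normedModType R) U U' (f : V -> W) :
  U' `<=` U -> smooth_on U f -> smooth_on U' f.
Proof. by move=> sU sf k; exact: Ck_subset (sf k). Qed.

Lemma smooth_on_derive (W : normedModType R) U (f : V -> W) v :
  smooth_on U f -> smooth_on U ('D_v f).
Proof. by move=> sf k; have [_] := sf k.+1; apply. Qed.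

Lemma smooth_on_differentiable (W : normedModType R) U (f : V -> W) x :
  smooth_on U f -> U x -> differentiable f x.
Proof. by move=> sf Ux; have [df _] := sf 1%N; exact: df. Qed.

Lemma Ck_sum k U (I : Type) (s : seq I) (f : I -> V -> R) : open U ->
  (forall i, Ck k U (f i)) -> Ck k U (fun x => \sum_(i <- s) f i x).
Proof.
move=> oU cf; elim: s => [|i s IHs].
  apply: (@Ck_ext _ _ _ _ _ (cst 0)) => //; last exact: Ck_cst.
  by move=> x _; rewrite big_nil.
apply: (@Ck_ext _ _ _ _ _ (f i + (fun x => \sum_(i <- s) f i x))) => //.
  by move=> x _; rewrite big_cons.
exact: CkD.
Qed.

Lemma Ck_coord m k U (f : V -> 'rV[R]_m) (j : 'I_m) : open U ->
  Ck k U f -> Ck k U (fun x => f x 0 j).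
Proof.
move=> oU; elim: k f => [|k IH] f.
  move=> cf x Ux; apply: (@continuous_comp _ _ _ f (fun y : 'rV[R]_m => y 0 j)).
    exact: cf.
  exact: coord_continuous.
move=> [df df']; split=> [x Ux|v].
  apply: (@differentiable_comp _ _ _ _ f (fun y : 'rV[R]_m => y 0 j : R)).
    exact: df.
  exact: differentiable_coord.
apply: (@Ck_ext _ _ _ _ _ (fun x => 'D_v f x 0 j)) => //; last exact: (IH _ (df' v)).
move=> x /set_mem Ux; rewrite derive_mx ?mxE//.
apply: diff_derivable; exact: df.
Qed.

Lemma row_derive_expand m (g : 'rV[R]_m -> R) (y w : 'rV[R]_m) :
  differentiable g y ->
  'D_w g y = \sum_j w 0 j * 'D_(delta_mx 0 j) g y.
Proof.
move=> dg; rewrite deriveE// {1}[w]row_sum_delta linear_sum.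
by apply: eq_bigr => j _; rewrite linearZ deriveE.
Qed.

(** By the chain rule the derivative of [g \o f] along [v] is a sum of products
    of components of ['D_v f] with partial derivatives of [g] composed with
    [f]; induction on [k] applies to the latter. *)
Lemma Ck_comp m k U (U' : set 'rV[R]_m) (f : V -> 'rV[R]_m) (g : 'rV[R]_m -> R) :
  open U -> (forall x, U x -> U' (f x)) ->
  Ck k U f -> Ck k U' g -> Ck k U (g \o f).
Proof.
move=> oU UU'; elim: k g => [|k IH] g.
  by move=> cf cg x Ux; apply: continuous_comp; [exact: cf|exact/cg/UU'].
move=> Cf [dg cg]; have [df cf] := Cf; split=> [x Ux|v].
  by apply: differentiable_comp; [exact: df|exact/dg/UU'].
apply: (@Ck_ext _ _ _ _ _
  (fun x => \sum_j 'D_v f x 0 j * ('D_(delta_mx 0 j) g \o f) x)) => //.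
  move=> x /set_mem Ux; have dfx := df _ Ux; have dgx := dg _ (UU' _ Ux).
  rewrite [RHS]deriveE; last exact: differentiable_comp.
  rewrite diff_comp//= -(deriveE _ dgx) row_derive_expand//.
  by rewrite (deriveE _ dfx).
apply: Ck_sum => // j; apply: CkM => //.
  exact: (Ck_coord j oU (cf v)).
exact: (IH _ (CkS Cf) (cg _)).
Qed.

Lemma smooth_on_comp m U (U' : set 'rV[R]_m) (f : V -> 'rV[R]_m)
    (g : 'rV[R]_m -> R) :
  open U -> (forall x, U x -> U' (f x)) ->
  smooth_on U f -> smooth_on U' g -> smooth_on U (g \o f).
Proof. by move=> oU UU' sf sg k; apply: Ck_comp UU' (sf k) (sg k). Qed.

(** A family of real functions that contains a derivative of each of its members
    consists of smooth functions. Quantifying over the whole family is what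
    makes the induction on [k] work: the chain rule replaces [g] by another
    member. *)
Lemma Ck_compR k U (f : V -> R) (S : set (R -> R)) :
  (forall g, S g -> exists2 g', S g' & forall t : R, is_derive t 1 g (g' t)) ->
  open U -> Ck k U f -> forall g, S g -> Ck k U (g \o f).
Proof.
move=> SD oU; elim: k => [|k IH] Cf g Sg; have [g' Sg' dg] := SD g Sg.
  move=> x Ux; apply: continuous_comp; first exact: Cf.
  by apply/differentiable_continuous/derivable1_diffP; have [] := dg (f x).
have dgx t : differentiable g t by apply/derivable1_diffP; have [] := dg t.
have [df cf] := Cf; split=> [x Ux|v].
  by apply: differentiable_comp; [exact: df|exact: dgx].
apply: (@Ck_ext _ _ _ _ _ ((g' \o f) * 'D_v f)) => //.
  move=> x /set_mem Ux; have dfx := df _ Ux.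
  rewrite [RHS]deriveE; last exact: differentiable_comp.
  rewrite diff_comp//= -(deriveE _ dfx) deriv1E; last by have [] := dg (f x).
  by have dgfx := dg (f x); rewrite derive1E derive_val mulrC.
by apply: CkM => //; [apply: (IH (CkS Cf))|exact: cf].
Qed.

Lemma smooth_on_ext (W : normedModType R) U (f g : V -> W) :
  open U -> {in U, f =1 g} -> smooth_on U f -> smooth_on U g.
Proof. by move=> oU fg sf k; exact: Ck_ext (sf k). Qed.

Lemma smooth_on_local (W : normedModType R) U (f : V -> W) :
  (forall x, U x -> exists2 U' : set V, U' x & smooth_on U' f) -> smooth_on U f.
Proof.
by move=> loc k; apply: Ck_local => x /loc[U' U'x sf]; exists U'.
Qed.

Lemma smooth_onM U (f g : V -> R) : open U ->
  smooth_on U f -> smooth_on U g -> smooth_on U (f * g).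
Proof. by move=> oU sf sg k; exact: CkM. Qed.

End CkCalculus.

Lemma smooth_on_coord (R : realType) n (j : 'I_n) (U : set 'rV[R]_n) :
  smooth_on U (fun x => x 0 j).
Proof.
move=> k; apply: (@Ck_subset _ _ _ _ setT) => //.
apply: (@Ck_coord _ _ n k setT id j) => //; first exact: openT.
case: k => [|k]; first by move=> x _; exact: cvg_id.
split=> [x _|v]; first exact: ex_diff.
have -> : 'D_v (id : 'rV[R]_n -> 'rV[R]_n) = cst v.
  by apply/funext => x; rewrite derive_id.
exact: Ck_cst.
Qed.

(** * Bump functions *)

Section FlatExp.
Variable R : realType.

(** For [P = 1] this is the classical function [exp(-1/t)] extended by 0. The
    polynomial factor in [1/t] makes the family stable under derivation. *)
Definition flat_exp (P : {poly R}) (t : R) : R :=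
  if 0 < t then P.[t^-1] * expR (- t^-1) else 0.

Lemma flat_exp_derive_gt0 P (t : R) : 0 < t ->
  is_derive t 1 (flat_exp P) (flat_exp ('X^2 * (P - P^`())) t).
Proof.
move=> t0; have t1 : t != 0 by rewrite gt_eqF.
have dinv : is_derive t 1 (fun s : R => s^-1) (- t ^- 2).
  by have := is_deriveV t1 (is_derive_id t (1 : R)); rewrite /GRing.scale/= mulr1.
have dP := is_derive1_comp (is_derive_poly P t^-1) dinv.
have dN := is_deriveN dinv.
have dE := @is_derive1_comp R expR (- (fun s : R => s^-1)) t _ _
  (is_derive_expR _) dN.
have dM := is_deriveM dP dE.
apply: (@near_eq_is_derive _ _ _ ((horner P \o (fun s : R => s^-1)) *
  (expR \o - (fun s : R => s^-1)))).
- near=> s; rewrite /flat_exp ifT//; near: s.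
  exact: lt_nbhsr.
- apply: is_derive_eq.
  rewrite /flat_exp t0 !hornerE /GRing.scale/= opprK exprVn.
  by rewrite -[(- (fun s : R => s^-1)) t]/(- t^-1); ring.
Unshelve. all: by end_near. Qed.

(** The exponential beats polynomials. The extra power [x ^+ k] makes the
    induction on the polynomial go through. *)
Lemma horner_expRN_bounded (P : {poly R}) (k : nat) :
  exists2 C : R, 0 <= C & forall x, 0 <= x -> x ^+ k * `|P.[x]| * expR (- x) <= C.
Proof.
elim/poly_ind: P k => [|P a IH] k.
  by exists 0 => // x _; rewrite horner0 normr0 mulr0 mul0r.
have [C C0 HC] := IH k.+1.
have [B B0 HB] : exists2 B : R, 0 <= B & forall x, 0 <= x -> x ^+ k * expR (- x) <= B.
  exists k`!%:R => // x x0; rewrite expRN ler_pdivrMr ?expR_gt0//.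
  case: k {HC} => [|k]; first by rewrite expr0 fact0 mul1r -expR0 ler_expR.
  have := expR_ge1Dxn k x0 => h.
  rewrite mulrC -ler_pdivrMr ?ltr0n ?fact_gt0//.
  by apply: le_trans h; rewrite lerDr.
exists (C + `|a| * B); first by rewrite addr_ge0// mulr_ge0.
move=> x x0; rewrite hornerD hornerM hornerX hornerC.
apply: (@le_trans _ _ (x ^+ k.+1 * `|P.[x]| * expR (- x) +
    `|a| * (x ^+ k * expR (- x)))); last by rewrite lerD ?HC// ler_wpM2l// HB.
apply: (@le_trans _ _ (x ^+ k * (`|P.[x] * x| + `|a|) * expR (- x))).
  by rewrite ler_wpM2r ?expR_ge0// ler_wpM2l ?exprn_ge0// ler_normD.
by rewrite normrM (ger0_norm x0) exprS le_eqVlt; apply/orP; left; apply/eqP; ring.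
Qed.

(** At the origin the function is bounded by a multiple of [t ^+ 2]: the
    previous bound, used with [x = 1/t] and [k = 2]. *)
Lemma flat_exp_derive0 P : is_derive (0 : R) 1 (flat_exp P) 0.
Proof.
have [C C0 HC] := horner_expRN_bounded P 2.
have fC (w : R) : `|flat_exp P w| <= C * w ^+ 2.
  rewrite /flat_exp; case: ifPn => [w0|_]; last first.
    by rewrite normr0 mulr_ge0// sqr_ge0.
  have := HC w^-1; rewrite invr_ge0 (ltW w0) => /(_ isT).
  rewrite normrM (ger0_norm (expR_ge0 _)) exprVn -mulrA mulrC.
  by rewrite ler_pdivrMr// exprn_gt0.
have bf e : 0 < e -> \forall w \near (0 : R),
    `|flat_exp P (w + 0) - (flat_exp P 0 + (\0 : {linear R^o -> R^o}) w)| <= e * `|w|.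
  move=> e0; near=> w; rewrite /= addr0 {2}/flat_exp ltxx addr0 subr0.
  rewrite (le_trans (fC w))// -(real_normK (num_real w)) expr2 mulrA ler_wpM2r//.
  rewrite (@le_trans _ _ ((C + 1) * `|w|))// ?ler_wpM2r ?lerDl//.
  rewrite mulrC -ler_pdivlMr ?ltr_wpDl//; apply: ltW; near: w.
  by apply: (@nbhs0_lt _ R^o); rewrite divr_gt0// ltr_wpDl.
have c0 : continuous (\0 : {linear R^o -> R^o}) by move=> w; exact: cvg_cst.
have [df dE] := @differentiable_of_bound R R^o R^o _ _ 0 c0 bf.
by apply: DeriveDef; [exact/derivable1_diffP|rewrite deriveE// dE].
Unshelve. all: by end_near. Qed.

Lemma flat_exp_derive P (t : R) :
  is_derive t 1 (flat_exp P) (flat_exp ('X^2 * (P - P^`())) t).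
Proof.
have [t0|t0|<-] := ltgtP 0 t; first exact: flat_exp_derive_gt0.
  have -> : flat_exp ('X^2 * (P - P^`())) t = 0 by rewrite /flat_exp ltNge (ltW t0).
  apply: (@near_eq_is_derive _ _ _ (cst 0)).
  near=> s; rewrite /flat_exp ifF//; apply/negbTE; rewrite -leNgt ltW//.
  by near: s; exact: lt_nbhsl.
have -> : flat_exp ('X^2 * (P - P^`())) 0 = 0 by rewrite /flat_exp ltxx.
exact: flat_exp_derive0.
Unshelve. all: by end_near. Qed.

Lemma smooth_on_flat_exp (V : normedModType R) (U : set V) (f : V -> R) :
  open U -> smooth_on U f -> smooth_on U (flat_exp 1 \o f).
Proof.
move=> oU sf k; apply: (@Ck_compR _ _ _ _ _ (range flat_exp)) => //.
  move=> _ [P _ <-]; exists (flat_exp ('X^2 * (P - P^`()))).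
    by exists ('X^2 * (P - P^`())).
  exact: flat_exp_derive.
Qed.

End FlatExp.

Section Bump.
Variables (R : realType) (n : nat).

Lemma smooth_on_sqdist (x0 : 'rV[R]_n) U :
  smooth_on U (fun x : 'rV[R]_n => \sum_j (x 0 j - x0 0 j) ^+ 2).
Proof.
move=> k; apply: (@Ck_subset _ _ _ _ setT) => //.
apply: Ck_sum; first exact: openT.
move=> j; have sc : Ck k setT (fun x : 'rV[R]_n => x 0 j - x0 0 j).
  apply: (@CkD _ _ _ _ _ (fun x : 'rV[R]_n => x 0 j) (cst (- x0 0 j))).
  - exact: openT.
  - exact: smooth_on_coord.
  - exact: Ck_cst.
by apply: CkM => //; exact: openT.
Qed.

(** With [E = flat_exp 1], [s] the squared distance to [x0] and [c = E a], the
    function [E (c - E (s - a))] is the constant [E c] where [s <= a], because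
    the inner [E] vanishes there, and 0 where [s >= 2 a], because [E] is
    nondecreasing. Dividing by the constant [E c] gives the bump function. *)
Lemma smooth_bump (x0 : 'rV[R]_n) (r : R) : 0 < r ->
  exists phi : 'rV[R]_n -> R, [/\ smooth_on setT phi,
    \forall x \near x0, phi x = 1 & forall x, phi x != 0 -> ball x0 r x].
Proof.
(* The support lies in s < 2 a = r^2, a Euclidean ball contained in the ball of
   radius r for the maximum norm. *)
move=> r0; pose a := r ^+ 2 / 2.
have a0 : 0 < a by rewrite divr_gt0// exprn_gt0.
pose s (x : 'rV[R]_n) : R := \sum_j (x 0 j - x0 0 j) ^+ 2.
pose c := flat_exp 1 a.
have c0 : 0 < c by rewrite /c /flat_exp a0 hornerE mul1r expR_gt0.
have s0 x : 0 <= s x by apply: sumr_ge0 => j _; exact: sqr_ge0.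
exists (fun x => flat_exp 1 (c - flat_exp 1 (s x - a)) / flat_exp 1 c); split.
- move=> k; apply: (@CkM _ _ _ _
    (flat_exp 1 \o (fun x => c - flat_exp 1 (s x - a))) (cst _)).
  + exact: openT.
  + apply: smooth_on_flat_exp; first exact: openT.
    move=> i; apply: (@CkD _ _ _ _ _ (cst c) (- (fun x => flat_exp 1 (s x - a)))).
    * exact: openT.
    * exact: Ck_cst.
    rewrite -mulN1r; apply: (@CkM _ _ _ _ (cst (-1))).
    * exact: openT.
    * exact: Ck_cst.
    apply: (@smooth_on_flat_exp _ _ _ (fun x => s x - a)); first exact: openT.
    move=> l; apply: (@CkD _ _ _ _ _ s (cst (- a))).
    * exact: openT.
    * exact: smooth_on_sqdist.
    * exact: Ck_cst.
  + exact: Ck_cst.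
- have cs : {for x0, continuous s} := @smooth_on_sqdist x0 setT 0%N x0 I.
  have sx0 : s x0 < a by rewrite /s big1// => j _; rewrite subrr expr0n.
  near=> x; have sa : s x < a.
    by near: x; exact: (cs _ (lt_nbhsl sx0)).
  have -> : flat_exp 1 (s x - a) = 0.
    by rewrite /flat_exp ifF// subr_gt0 ltNge (ltW sa).
  by rewrite subr0 divff// /flat_exp c0 hornerE mul1r gt_eqF// expR_gt0.
- move=> x /eqP phi0; apply: contrapT => xr; apply: phi0.
  have sr : r ^+ 2 <= s x.
    have /existsP[j rj] : [exists j, r <= `|x 0 j - x0 0 j|].
      apply: contraT => /existsPn rj; exfalso; apply: xr; rewrite -ball_normE/= -normrN opprB.
      rewrite [ltLHS]/Num.Def.normr/= mx_normrE.
      apply: bigmax_lt => // -[i j] _ /=.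
      by have := rj j; rewrite -ltNge !mxE !ord1.
    rewrite /s (bigD1 j)//= -(real_normK (num_real (_ - _))) -[leLHS]addr0 lerD//.
      by rewrite ler_pXn2r// nnegrE// ltW.
    by apply: sumr_ge0 => i _; exact: sqr_ge0.
  rewrite {1}/flat_exp ifF ?mul0r//; apply/negbTE; rewrite -leNgt subr_le0.
  have aa : a <= s x - a by rewrite lerBrDr -splitr.
  rewrite /c /flat_exp a0 (lt_le_trans a0 aa) !hornerE ler_expR lerN2.
  by rewrite lef_pV2// posrE// (lt_le_trans a0).
Unshelve. all: by end_near. Qed.
End Bump.

(** * The Hadamard lemma *)

Lemma near_ball_shift (R : realType) (V : normedModType R) (y x : V) (r : R) :
  ball y r x -> \forall w \near (0 : V), ball y r (w + x).
Proof.
move=> xB; have d0 : 0 < r - `|y - x| by rewrite subr_gt0; rewrite -ball_normE in xB.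
near=> w; rewrite -ball_normE/= [w + x]addrC opprD addrA.
rewrite (le_lt_trans (ler_normB _ _))// -ltrBrDl.
by near: w; exact: nbhs0_lt.
Unshelve. all: by end_near. Qed.

Section Hadamard.
Variables (R : realType) (n : nat).
Local Notation W := 'rV[R]_n.
Local Notation mu := (@lebesgue_measure R).

Lemma lebesgue_measure_unit : fine (mu (`[0, 1]%classic : set R)) = 1.
Proof. by rewrite lebesgue_measure_itv/= lte_fin ltr01 -EFinB/= subr0. Qed.

Lemma ray_diff (V : normedModType R) (z w : V) (s : R) :
  is_diff s (fun t : R => z + t *: w) (fun t => t *: w).
Proof.
apply: is_diff_eq.
by rewrite add0r.
Qed.

Lemma ray_derive (h : W -> R) (z w : W) (s : R) :
  differentiable h (z + s *: w) ->
  is_derive s 1 (fun t : R => h (z + t *: w)) ('D_w h (z + s *: w)).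
Proof.
move=> dh; have dr := ray_diff z w s.
have dhr : differentiable (h \o (fun t : R => z + t *: w)) s.
  by apply: differentiable_comp => //; exact: ex_diff.
apply: DeriveDef; first exact/derivable1_diffP.
rewrite (@deriveE _ _ _ (h \o (fun t : R => z + t *: w)))// diff_comp//.
by rewrite diff_val/= scale1r deriveE.
Qed.

(** Strict differentiability of a function with continuous partial derivatives:
    the mean value theorem on the segment from [z'] to [z' + w] bounds the
    remainder by the oscillation of the partial derivatives. The uniformity in
    [z'] is what allows integrating the estimate along a segment. *)
Lemma strict_differentiable (U : set W) (h : W -> R) (z : W) (e : R) :
  open U -> smooth_on U h -> U z -> 0 < e ->
  \forall z' \near z & w \near (0 : W),
    `|h (z' + w) - h z' - 'D_w h z'| <= e * `|w|.
Proof.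
move=> oU sh Uz e0.
(* Each of the n partial derivatives is compared twice with its value at z;
   n.+1 replaces n, which may be 0. *)
pose e' := e / (2 * n.+1%:R).
have e'0 : 0 < e' by rewrite divr_gt0// mulr_gt0.
have nearD : \forall z'' \near z, U z'' /\ forall j,
    `|'D_(delta_mx 0 j) h z'' - 'D_(delta_mx 0 j) h z| <= e'.
  have nj (j : 'I_n) : \forall z'' \near z,
      `|'D_(delta_mx 0 j) h z'' - 'D_(delta_mx 0 j) h z| <= e'.
    have cj := smooth_on_derive (delta_mx 0 j) sh 0%N z Uz.
    by move/cvgrPdist_le : cj => /(_ _ e'0); apply: filterS => a; rewrite distrC.
  have Uz' : \forall z'' \near z, U z'' by exact: (open_nbhs_nbhs (conj oU Uz)).
  have nj' : \forall z'' \near z, forall j : 'I_n,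
      `|'D_(delta_mx 0 j) h z'' - 'D_(delta_mx 0 j) h z| <= e'.
    exact: filter_forall nj.
  by apply: filterS (filterI Uz' nj') => a [].
have [rho /= rho0 hrho] := (nbhs_ballP _ _).1 nearD.
exists (ball z (rho / 2), ball (0 : W) (rho / 2)).
  by split; apply: nbhsx_ballx; rewrite divr_gt0.
move=> [z' w] /= [zz' w0].
have segB (s : R) : 0 <= s <= 1 -> ball z rho (z' + s *: w).
  move=> /andP[s0 s1]; rewrite -ball_normE/= opprD addrA.
  rewrite (le_lt_trans (ler_normB _ _))// (splitr rho) ltr_leD//.
    by rewrite -ball_normE in zz'.
  rewrite normrZ ger0_norm// (le_trans (ler_piMl _ s1))//.
  by move: w0; rewrite -ball_normE/= sub0r normrN => /ltW.
have segU (s : R) : 0 <= s <= 1 -> differentiable h (z' + s *: w).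
  by move=> /segB/hrho[Us _]; exact: smooth_on_differentiable sh Us.
have dray (s : R) : 0 <= s <= 1 ->
    is_derive s 1 (fun t : R => h (z' + t *: w)) ('D_w h (z' + s *: w)).
  by move=> s01; apply: ray_derive; exact: segU.
have [||c c01] := @MVT_segment R (fun t : R => h (z' + t *: w))
    (fun s => 'D_w h (z' + s *: w)) 0 1 ler01.
- by move=> s; rewrite in_itv/= => /andP[/ltW s0 /ltW s1]; apply: dray; rewrite s0.
- apply: continuous_in_subspaceT => s /set_mem/=; rewrite in_itv/= => s01.
  by apply/differentiable_continuous/derivable1_diffP; have [] := dray s s01.
move: c01; rewrite in_itv/= => c01.
rewrite scale1r scale0r addr0 subr0 mulr1 => ->.
have z'B : (0 <= 0 :> R) && (0 <= 1 :> R) by rewrite lexx ler01.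
have U0 := segU _ z'B; rewrite scale0r addr0 in U0.
have [_ H0] := hrho _ (segB _ z'B); rewrite scale0r addr0 in H0.
have [_ Hc] := hrho _ (segB _ c01).
rewrite (row_derive_expand _ (segU _ c01)) (row_derive_expand _ U0) -sumrB.
apply: (le_trans (ler_norm_sum _ _ _)).
apply: (@le_trans _ _ (\sum_(j < n) `|w| * (e' + e'))).
  apply: ler_sum => j _; rewrite -mulrBr normrM ler_pM//.
    rewrite [leRHS]/Num.Def.normr/= mx_normrE.
    exact: (le_bigmax _ (fun i => `|w i.1 i.2|) (0, j)).
  rewrite -(subrKA ('D_(delta_mx 0 j) h z)) (le_trans (ler_normD _ _))//.
  by rewrite lerD// distrC.
rewrite sumr_const card_ord -mulr_natr -mulrA mulrC ler_wpM2r//.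
rewrite /e'; have -> : (e / (2 * n.+1%:R) + e / (2 * n.+1%:R)) = e / n.+1%:R.
  by rewrite invfM mulrA -mulrDl -splitr.
by rewrite mulrAC ler_pdivrMr// ler_wpM2l// ?ler_nat// ltW.
Qed.

Variables (y : W) (r : R).

(** The weight [t ^+ m] is there because each derivation along the segment from
    [y] to [x] brings out a factor [t]. *)
Definition radial_mean (m : nat) (h : W -> R) (x : W) : R :=
  \int[mu]_(t in `[0, 1]) (t ^+ m * h (y + t *: (x - y))).

Lemma ray_ball (x : W) (t : R) : ball y r x -> 0 <= t <= 1 ->
  ball y r (y + t *: (x - y)).
Proof.
rewrite -ball_normE/= => xB /andP[t0 t1].
rewrite opprD addrA subrr sub0r normrN normrZ ger0_norm// distrC.
by rewrite (le_lt_trans _ xB)// ler_piMl// .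
Qed.

Lemma ray_continuous (h : W -> R) (x : W) (t : R) : smooth_on (ball y r) h ->
  ball y r x -> 0 <= t <= 1 ->
  {for t, continuous (fun t : R => h (y + t *: (x - y)))}.
Proof.
move=> sh xB t01; apply/differentiable_continuous/derivable1_diffP.
by have [] := ray_derive (smooth_on_differentiable sh (ray_ball xB t01)).
Qed.

Lemma radial_mean_integrable m (h : W -> R) (x : W) :
  smooth_on (ball y r) h -> ball y r x ->
  mu.-integrable `[0, 1] (EFin \o (fun t : R => t ^+ m * h (y + t *: (x - y)))).
Proof.
move=> sh xB; apply: continuous_compact_integrable; first exact: segment_compact.
apply: continuous_in_subspaceT => t /set_mem/=; rewrite in_itv/= => t01.
apply: (@continuousM _ R (fun t : R => t ^+ m)); first exact: exprn_continuous.
exact: ray_continuous.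
Qed.

Lemma radial_meanD m (h1 h2 : W -> R) (x : W) :
  smooth_on (ball y r) h1 -> smooth_on (ball y r) h2 -> ball y r x ->
  radial_mean m (h1 + h2) x = radial_mean m h1 x + radial_mean m h2 x.
Proof.
move=> s1 s2 xB; rewrite /radial_mean -RintegralD//; last 2 first.
  exact: radial_mean_integrable.
  exact: radial_mean_integrable.
by apply: eq_Rintegral => t _; rewrite -mulrDr.
Qed.

Lemma radial_mean_sum m (h : 'I_n -> W -> R) (a : 'I_n -> R) (x : W) :
  (forall j, smooth_on (ball y r) (h j)) -> ball y r x ->
  radial_mean m (fun z => \sum_j a j * h j z) x =
  \sum_j a j * radial_mean m (h j) x.
Proof.
move=> sh xB.
have : smooth_on (ball y r) (fun z => \sum_j a j * h j z) /\
    radial_mean m (fun z => \sum_j a j * h j z) x =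
    \sum_j a j * radial_mean m (h j) x; last by case.
elim: (index_enum _) => [|i s [ss IH]].
  split.
    have -> : (fun z => \sum_(j <- [::]) a j * h j z) = cst 0.
      by apply/funext => z; rewrite big_nil.
    by move=> k; exact: Ck_cst.
  rewrite big_nil /radial_mean.
  under eq_Rintegral do rewrite big_nil mulr0.
  by rewrite /Rintegral integral0.
have oB : open (ball y r) by exact: ball_open.
have sa : smooth_on (ball y r) (cst (a i) * h i).
  by apply: smooth_onM => // k; exact: Ck_cst.
have E : (fun z => \sum_(j <- i :: s) a j * h j z) =
    (cst (a i) * h i) + (fun z => \sum_(j <- s) a j * h j z).
  by apply/funext => z; rewrite big_cons.
rewrite E; split; first by move=> k; apply: CkD; [exact: oB|exact: sa|exact: ss].
rewrite radial_meanD// IH big_cons; congr (_ + _).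
rewrite /radial_mean -RintegralZl//; last exact: radial_mean_integrable.
by apply: eq_Rintegral => t _; rewrite mulrCA.
Qed.

(** Derivation under the integral sign. Strict differentiability holds near each
    point of the segment from [y] to [x]; compactness of the unit interval makes
    it uniform, and the resulting bound is integrated. *)
Lemma radial_mean_diff m (h : W -> R) (x : W) : smooth_on (ball y r) h ->
  ball y r x ->
  differentiable (radial_mean m h) x /\
  forall v, 'D_v (radial_mean m h) x = radial_mean m.+1 ('D_v h) x.
Proof.
move=> sh xB; have oB : open (ball y r) by exact: ball_open.
have sd j := smooth_on_derive (delta_mx 0 j) sh.
pose c j := radial_mean m.+1 ('D_(delta_mx 0 j) h) x.
pose L (v : W) : R := \sum_j v 0 j * c j.
have LE v : L v = radial_mean m.+1 ('D_v h) x.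
  rewrite /L /c -(radial_mean_sum _ _ sd)//; apply: eq_Rintegral => t.
  move=> /set_mem/=; rewrite in_itv/= => t01; congr (_ * _).
  rewrite -row_derive_expand//.
  exact: smooth_on_differentiable sh (ray_ball xB t01).
have Ll : linear L.
  move=> a u v; rewrite /L scaler_sumr -big_split/=; apply: eq_bigr => j _.
  by rewrite !mxE mulrDl -mulrA.
pose LM := GRing.isLinear.Build _ _ _ _ _ Ll.
pose LL : {linear W -> R} := HB.pack L LM.
have Lc : continuous LL.
  move=> v; apply: (@Ck_sum _ _ 0 setT _ _ (fun j (v : W) => v 0 j * c j)) => //.
    exact: openT.
  move=> j; apply: (@CkM _ _ 0 _ (fun v : W => v 0 j) (cst (c j))).
  - exact: openT.
  - exact: smooth_on_coord.
  - exact: Ck_cst.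
suff : forall e, 0 < e -> \forall w \near (0 : W),
    `|radial_mean m h (w + x) - (radial_mean m h x + L w)| <= e * `|w|.
  move=> bm; have [dm dE] := @differentiable_of_bound R W R^o _ LL x Lc bm.
  by split=> // v; rewrite deriveE// dE -LE.
move=> e e0.
have near01 : \forall w \near (0 : W), `[0, 1]%classic `<=`
    (fun t : R => `|h (y + t *: (x - y) + t *: w) - h (y + t *: (x - y))
      - 'D_(t *: w) h (y + t *: (x - y))| <= e * `|t *: w|).
  have /compact_near_coveringP cv := @segment_compact R 0 1.
  apply: (cv _ _ _ (nbhs_filter (0 : W))) => t /=; rewrite in_itv/= => t01.
  have [[A B] /= [nA nB] AB] :=
    strict_differentiable oB sh (ray_ball xB t01) e0.
  have [[P Q] /= [nP nQ] PQ] :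
      \forall t' \near t & w \near (0 : W), B (t' *: w).
    have sc := @scale_continuous R W (t, 0); apply: sc.
    by rewrite /= scaler0.
  have nA' : \forall t' \near t, A (y + t' *: (x - y)).
    have [dr _] := ray_diff y (x - y) t.
    exact: (differentiable_continuous dr nA).
  exists ([set t' | P t' /\ A (y + t' *: (x - y))], Q).
    by split => //=; apply: filterS (filterI nP nA') => t' [].
  move=> [t' w] /= [[Pt' At'] Qw]; apply: (AB (_, _)); split => //=.
  exact: (PQ (t', w)).
have nearB : \forall w \near (0 : W), ball y r (w + x).
  exact: near_ball_shift.
near=> w.
have wB : ball y r (w + x) by near: w.
have hw : `[0, 1]%classic `<=`
    (fun t : R => `|h (y + t *: (x - y) + t *: w) - h (y + t *: (x - y))
      - 'D_(t *: w) h (y + t *: (x - y))| <= e * `|t *: w|) by near: w.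
have i1 := radial_mean_integrable m sh wB.
have i2 := radial_mean_integrable m sh xB.
have i3 := radial_mean_integrable m.+1 (smooth_on_derive w sh) xB.
have mI : measurable (`[0, 1]%classic : set (measurableTypeR R)).
  exact: measurable_itv.
have i23 : mu.-integrable `[0, 1] (EFin \o (fun t : R =>
    t ^+ m * h (y + t *: (x - y)) + t ^+ m.+1 * 'D_w h (y + t *: (x - y)))).
  exact: (integrableD mI i2 i3).
have i123 := integrableB mI i1 i23.
rewrite LE /radial_mean -RintegralD// -RintegralB//.
apply: (le_trans (le_normr_Rintegral mI i123)).
apply: (@le_trans _ _ (\int[mu]_(t in `[0, 1]) (e * `|w|))).
  apply: le_Rintegral => //.
  - exact: (integrable_abse i123).
  - apply: continuous_compact_integrable; first exact: segment_compact.
    by apply: continuous_subspaceT => ?; exact: cvg_cst.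
  move=> t t01; have := hw t t01; move: t01; rewrite /= in_itv/= => t01.
  have dz := smooth_on_differentiable sh (ray_ball xB t01).
  rewrite (deriveE _ dz) linearZ -(deriveE _ dz) normrZ.
  have -> : y + t *: (w + x - y) = y + t *: (x - y) + t *: w.
    by rewrite -[RHS]addrA -scalerDr; congr (_ + _ *: _); rewrite -addrA addrC.
  move: (y + t *: (x - y)) => z hz.
  have -> : t ^+ m * h (z + t *: w) - (t ^+ m * h z + t ^+ m.+1 * 'D_w h z) =
      t ^+ m * (h (z + t *: w) - h z - t *: 'D_w h z).
    by rewrite exprSr /GRing.scale/=; ring.
  move/andP: t01 => [t0 t1].
  rewrite normrM (ger0_norm (exprn_ge0 m t0)).
  apply: (@le_trans _ _ `|h (z + t *: w) - h z - t *: 'D_w h z|).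
    by rewrite ler_piMl// exprn_ile1.
  by rewrite (le_trans hz)// (ler_wpM2l (ltW e0))// (ger0_norm t0) ler_piMl.
by rewrite Rintegral_cst// (_ : fine _ = 1) ?mulr1//; exact: lebesgue_measure_unit.
Unshelve. all: by end_near. Qed.

Lemma smooth_on_radial_mean m (h : W -> R) : smooth_on (ball y r) h ->
  smooth_on (ball y r) (radial_mean m h).
Proof.
move=> sh k; elim: k m h sh => [|k IH] m h sh.
  move=> x xB; apply: differentiable_continuous.
  by have [] := radial_mean_diff m sh xB.
split=> [x xB|v]; first by have [] := radial_mean_diff m sh xB.
apply: (@Ck_ext _ _ _ _ _ (radial_mean m.+1 ('D_v h))).
- exact: ball_open.
- by move=> x /set_mem xB; have [_ ->] := radial_mean_diff m sh xB.
- by apply: IH; exact: smooth_on_derive.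
Qed.

Lemma radial_mean_center (h : W -> R) : radial_mean 0 h y = h y.
Proof.
rewrite /radial_mean; under eq_Rintegral do rewrite subrr scaler0 addr0 expr0 mul1r.
by rewrite Rintegral_cst// (_ : fine _ = 1) ?mulr1//; exact: lebesgue_measure_unit.
Qed.

(** [g j] is the mean of the [j]-th partial derivative of [f] over the segment
    from [y] to [x]; the formula is the fundamental theorem of calculus on that
    segment. *)
Theorem hadamard (f : W -> R) : smooth_on (ball y r) f ->
  exists g : 'I_n -> W -> R,
    [/\ forall j, smooth_on (ball y r) (g j),
        forall j, g j y = 'D_(delta_mx 0 j) f y &
        forall x, ball y r x -> f x = f y + \sum_j (x - y) 0 j * g j x].
Proof.
move=> sf; have sd j := smooth_on_derive (delta_mx 0 j) sf.
exists (fun j => radial_mean 0 ('D_(delta_mx 0 j) f)); split=> [j|j|x xB].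
- exact: smooth_on_radial_mean.
- exact: radial_mean_center.
rewrite -radial_mean_sum//; apply/eqP; rewrite addrC -subr_eq; apply/eqP.
have dray (t : R) : 0 <= t <= 1 ->
    is_derive t 1 (fun t : R => f (y + t *: (x - y))) ('D_(x - y) f (y + t *: (x - y))).
  by move=> t01; apply: ray_derive; exact: smooth_on_differentiable sf (ray_ball xB t01).
have cray (t : R) : 0 <= t <= 1 ->
    {for t, continuous (fun t : R => f (y + t *: (x - y)))}.
  by move=> t01; exact: ray_continuous.
have -> : radial_mean 0 (fun z => \sum_j (x - y) 0 j * 'D_(delta_mx 0 j) f z) x =
    \int[mu]_(t in `[0, 1]) 'D_(x - y) f (y + t *: (x - y)).
  apply: eq_Rintegral => t; rewrite inE/= in_itv/= => t01.
  rewrite expr0 mul1r -row_derive_expand//.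
  exact: smooth_on_differentiable sf (ray_ball xB t01).
rewrite /Rintegral (@continuous_FTC2 _ _ (fun t : R => f (y + t *: (x - y))))//=.
- by rewrite scale1r scale0r addr0 [y + (x - y)]addrC subrK.
- apply: continuous_in_subspaceT => t /set_mem/=; rewrite in_itv/= => t01.
  exact: ray_continuous (smooth_on_derive (x - y) sf) xB t01.
- split.
  + by move=> t; rewrite in_itv/= => /andP[/ltW t0 /ltW t1]; have [] := dray t; rewrite ?t0.
  + by apply: cvg_at_right_filter; apply: cray; rewrite lexx ler01.
  + by apply: cvg_at_left_filter; apply: cray; rewrite lexx ler01.
- move=> t; rewrite in_itv/= => /andP[/ltW t0 /ltW t1].
  have dt : 0 <= t <= 1 by rewrite t0.
  by have d := dray t dt; rewrite derive1E derive_val.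
Qed.

End Hadamard.

(** * Tangent vectors and vector fields, pointwise *)

Section Pointwise.
Variables (R : realType) (n : nat) (M : manifold R n).
Local Notation Coo := (smooth_function M).
Local Notation VF := (vector_field M).

Section Derivation.
Variables (q : M) (v : tangent q).

Lemma tangentD f g : v (f + g) = v f + v g.
Proof. by have [-> _ _] := tangentP v. Qed.

Lemma tangentM f g : v (f * g) = v f * g q + f q * v g.
Proof. by have [_ _ ->] := tangentP v. Qed.

Lemma tangent1 : v 1 = 0.
Proof.
have := tangentM 1 1; have -> : (1 : Coo) q = 1 by [].
by rewrite !mulr1 mul1r -[LHS]addr0 => /addrI.
Qed.

Lemma tangent_const a : v (smooth_const M a) = 0.
Proof.
have [_ vZ _] := tangentP v.
by rewrite -[smooth_const M a]mulr1 vZ tangent1 mulr0.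
Qed.

Lemma tangent0 : v 0 = 0.
Proof. by have := tangentD 0 0; rewrite addr0 -[LHS]addr0 => /addrI. Qed.

Lemma tangentN f : v (- f) = - v f.
Proof. by apply: (addrI (v f)); rewrite -tangentD !subrr tangent0. Qed.

Lemma tangent_sum (I : Type) (s : seq I) (F : I -> Coo) :
  v (\sum_(i <- s) F i) = \sum_(i <- s) v (F i).
Proof. exact: (big_morph _ tangentD tangent0). Qed.

End Derivation.

Lemma smooth_sumE (I : Type) (s : seq I) (F : I -> Coo) (p : M) :
  (\sum_(i <- s) F i) p = \sum_(i <- s) F i p.
Proof. by apply: (big_morph (fun f : Coo => f p)). Qed.

Lemma vf_addE (X Y : VF) p f : (X + Y) p f = X p f + Y p f.
Proof. exact: (tangentDE (X p) (Y p) f). Qed.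

Lemma vf_oppE (X : VF) p f : (- X) p f = - X p f.
Proof. exact: (tangentNE (X p) f). Qed.

Lemma vf_zeroE p f : (0 : VF) p f = 0.
Proof. exact: tangent0E. Qed.

Lemma vf_scaleE (h : Coo) (X : VF) p f : (h *: X) p f = h p * X p f.
Proof. exact: (tangentZE (h p) (X p) f). Qed.

Lemma lie_bracketE (X Y : VF) p f :
  lie_bracket X Y p f = X p (vf_app Y f) - Y p (vf_app X f).
Proof. by []. Qed.

(** Rules that turn an identity between vector fields, evaluated at a point and
    a function, into an identity in [R]. *)
Definition vfE := (vf_addE, vf_oppE, vf_zeroE, vf_scaleE).

Lemma vf_app_add (X Y : VF) f : vf_app (X + Y) f = vf_app X f + vf_app Y f.
Proof. by apply/val_inj/funext => p; exact: vf_addE. Qed.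

Lemma vf_app_scale (h : Coo) (X : VF) f : vf_app (h *: X) f = h * vf_app X f.
Proof. by apply/val_inj/funext => p; exact: vf_scaleE. Qed.

Lemma vf_sumE (I : Type) (s : seq I) (F : I -> VF) p g :
  (\sum_(i <- s) F i) p g = \sum_(i <- s) F i p g.
Proof.
exact: (big_morph (fun X : VF => X p g) (fun X Y => vf_addE X Y p g) (vf_zeroE p g)).
Qed.

End Pointwise.

(** * Charts and local frames *)

(* From here on coord and coord_continuous refer to charts, not to vector bases
   and matrices. *)
Import Pilot.Defs.

Lemma open_setI_preimage (S T : topologicalType) (f : S -> T) (A : set S)
    (B : set T) :
  open A -> (forall x, A x -> {for x, continuous f}) -> open B ->
  open (A `&` f @^-1` B).
Proof.
move=> oA cf oB; rewrite openE => x [Ax Bx]; apply: filterI.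
  exact: open_nbhs_nbhs.
exact: (cf x Ax _ (open_nbhs_nbhs (conj oB Bx))).
Qed.

Section Charts.
Variables (R : realType) (n : nat) (M : manifold R n).
Local Notation Coo := (smooth_function M).
Local Notation VF := (vector_field M).
Implicit Types (c d : chart R n M).

Definition extend_by_zero c (h : 'rV[R]_n -> R) (p : M) : R :=
  if `[< dom c p >] then h (coord c p) else 0.

Lemma extend_by_zero_in c h p : dom c p -> extend_by_zero c h p = h (coord c p).
Proof. by move=> cp; rewrite /extend_by_zero asboolT. Qed.

Lemma extend_by_zeroM_in c (phi h : 'rV[R]_n -> R) p : dom c p ->
  extend_by_zero c (phi * h) p = phi (coord c p) * h (coord c p).
Proof. exact: extend_by_zero_in. Qed.

Lemma extend_by_zero_out c h p : ~ dom c p -> extend_by_zero c h p = 0.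
Proof. by move=> cp; rewrite /extend_by_zero asboolF. Qed.

(** Around a point outside the closed set [param c @` K] the extension vanishes;
    around any other point it is read in another chart through a transition
    map. *)
Lemma smooth_extend_by_zero c (U K : set 'rV[R]_n) (h : 'rV[R]_n -> R) :
  atlas c -> open U -> U `<=` cod c -> K `<=` U -> closed (param c @` K) ->
  smooth_on U h -> (forall x, h x != 0 -> K x) -> smooth (extend_by_zero c h).
Proof.
move=> Ac oU Uc KU cK sh hK d Ad; apply: smooth_on_local => x dx.
have oT : open (cod d `&` param d @^-1` dom c).
  apply: open_setI_preimage; [exact: cod_open|exact: param_continuous|].
  exact: dom_open.
have [[cx Ux]|nUx] := pselect (dom c (param d x) /\ U (coord c (param d x))).
  pose U' := (cod d `&` param d @^-1` dom c) `&` (coord c \o param d) @^-1` U.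
  exists U' => //.
  have oU' : open U'.
    apply: open_setI_preimage => // z [dz cz]; apply: continuous_comp.
      exact: param_continuous.
    exact: coord_continuous.
  apply: (@smooth_on_ext _ _ _ _ (h \o (coord c \o param d))) => //.
    by move=> z /set_mem[[dz cz] Uz] /=; rewrite extend_by_zero_in.
  apply: (@smooth_on_comp _ _ _ _ U) => //; first by move=> z [].
  by apply: smooth_on_subset (atlas_compatible Ad Ac) => z [].
pose U' := cod d `&` param d @^-1` (~` (param c @` K)).
have oU' : open U'.
  apply: open_setI_preimage; [exact: cod_open|exact: param_continuous|].
  by rewrite openC.
exists U'.
  split=> //= -[k Kk kx]; apply: nUx; rewrite -kx.
  by split; [exact/param_dom/Uc/KU|rewrite paramK; [exact: KU|exact/Uc/KU]].
apply: (@smooth_on_ext _ _ _ _ (cst 0)) => //; last by move=> k; exact: Ck_cst.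
move=> z /set_mem[dz /= Kz]; have [cz|ncz] := pselect (dom c (param d z)).
  rewrite extend_by_zero_in//; apply/esym/eqP; apply: contraT => /hK Kcz.
  by case: Kz; exists (coord c (param d z)) => //; rewrite coordK.
by rewrite extend_by_zero_out.
Qed.

(** The support of the bump function is a compact subset of [U]. Its image in [M]
    is closed because [M] is Hausdorff. *)
Lemma chart_bump c (U : set 'rV[R]_n) (x0 : 'rV[R]_n) :
  atlas c -> open U -> U `<=` cod c -> U x0 ->
  exists phi : 'rV[R]_n -> R,
    [/\ \forall x \near x0, phi x = 1, forall x, phi x != 0 -> U x
      & forall h, smooth_on U h -> smooth (extend_by_zero c (phi * h))].
Proof.
move=> Ac oU Uc Ux0.
have [e /= e0 eU] := (nbhs_ballP _ _).1 (open_nbhs_nbhs (conj oU Ux0)).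
have e20 : 0 < e / 2 by rewrite divr_gt0.
have [phi [sphi phi1 phiB]] := smooth_bump x0 e20.
have KU : closed_ball x0 (e / 2) `<=` U.
  apply: subset_trans eU; apply: closed_ball_subset => //.
  by rewrite gtr_pMr// invf_lt1// ltr1n.
have phiK x : phi x != 0 -> closed_ball x0 (e / 2) x.
  by move=> /phiB; exact: subset_closed_ball.
exists phi; split=> //; first by move=> x /phiK/KU.
move=> h sh; apply: (smooth_extend_by_zero (U := U) (K := closed_ball x0 (e / 2))) => //.
- apply: compact_closed; first exact: manifold_hausdorff.
  apply: continuous_compact.
    apply: continuous_in_subspaceT => x /set_mem/KU/Uc; exact: param_continuous.
  apply: bounded_closed_compact; last exact: closed_ball_closed.
  exists (`|x0| + e / 2); split; first exact: num_real.
  move=> b xb x; rewrite closed_ballE// /closed_ball_/= => xr.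
  rewrite -[x](subrK x0) (le_trans (ler_normD _ _))// addrC ltW//.
  by rewrite (le_lt_trans _ xb)// lerD// distrC.
- apply: smooth_onM => //; exact: smooth_on_subset sphi.
- by move=> x; rewrite /GRing.mul/= mulf_eq0 negb_or => /andP[/phiK].
Qed.

(** Write [g = g(q) + sum_j (x_j - x_j(q)) h_j] near [q] by the Hadamard lemma,
    multiply by a bump function to get an identity between global smooth
    functions, and apply the derivation [v]: only the terms in which [v] falls
    on [f_j - f_j(q)] survive. The functions [f j] are global functions that
    agree with the coordinates near [q]. *)
Lemma tangent_expand c (q : M) (v : tangent q) (U : set 'rV[R]_n) (f : 'I_n -> Coo)
    (g : Coo) :
  atlas c -> dom c q -> open U -> U `<=` cod c -> U (coord c q) ->
  (forall j p, dom c p -> U (coord c p) -> f j p = coord c p 0 j) ->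
  v g = \sum_j v (f j) * 'D_(delta_mx 0 j) (g \o param c) (coord c q).
Proof.
move=> Ac cq oU Uc Uq fE; set y := coord c q.
have [r /= r0 rU] := (nbhs_ballP _ _).1 (open_nbhs_nbhs (conj oU Uq)).
have sg : smooth_on (ball y r) (g \o param c).
  by apply: smooth_on_subset (smooth_functionP g Ac) => z /rU/Uc.
have [h [sh hy hE]] := hadamard sg.
have [phi [phi1 phiB sphi]] := chart_bump Ac (ball_open y r)
  (subset_trans rU Uc) (ballxx y r0).
have s1 : smooth_on (ball y r) (cst (1 : R) : 'rV[R]_n -> R) by move=> k; exact: Ck_cst.
pose chi : Coo := mk_smooth (sphi _ s1).
pose G j : Coo := mk_smooth (sphi _ (sh j)).
have E : chi * (g - smooth_const M (g q)) =
    \sum_j (f j - smooth_const M (y 0 j)) * G j.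
  apply/val_inj/funext => p; rewrite [RHS]smooth_sumE.
  transitivity (extend_by_zero c (phi * cst 1) p * (g p - g q)) => //.
  transitivity (\sum_j (f j p - y 0 j) * extend_by_zero c (phi * h j) p) => //.
  have [cp|ncp] := pselect (dom c p); last first.
    rewrite extend_by_zero_out// mul0r big1// => j _.
    by rewrite extend_by_zero_out// mulr0.
  rewrite extend_by_zeroM_in//; set z := coord c p.
  under eq_bigr do rewrite extend_by_zeroM_in// -/z mulrCA.
  rewrite -mulr_sumr mulr1.
  have [->|/phiB zB] := eqVneq (phi z) 0; first by rewrite !mul0r.
  congr (_ * _); have /= := hE z zB; rewrite /z /y !coordK// => ->.
  rewrite addrAC subrr add0r; apply: eq_bigr => j _.
  by rewrite !mxE fE//; exact: rU.
have phiy : phi y = 1 by exact: (nbhs_singleton phi1).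
have chiq : chi q = 1 by rewrite /chi/= extend_by_zeroM_in// -/y phiy mulr1.
have gq : (g - smooth_const M (g q)) q = 0 by exact: subrr.
have := congr1 v E; rewrite tangentM gq mulr0 add0r chiq mul1r.
rewrite tangentD tangentN tangent_const subr0 => ->.
rewrite tangent_sum; apply: eq_bigr => j _.
have fq : (f j - smooth_const M (y 0 j)) q = 0.
  by apply/eqP; rewrite subr_eq0; apply/eqP; exact: fE.
rewrite tangentM fq mul0r addr0 tangentD tangentN tangent_const subr0.
by rewrite /G/= extend_by_zeroM_in// -/y phiy mul1r hy.
Qed.

(** The coordinates and the coordinate fields are cut off by two different bump
    functions: the one for the coordinates is 1 wherever the one for the fields
    is nonzero, so that [tangent_expand] applies at all these points. *)
Lemma local_frame (p : M) :
  exists (phi : Coo) (f : 'I_n -> Coo) (E : 'I_n -> VF),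
    (\forall q \near p, phi q = 1) /\
    (forall q (v : tangent q) g, phi q * v g = \sum_j v (f j) * E j q g).
Proof.
have [c Ac cp] := atlas_cover p.
set x0 := coord c p.
have cx0 : cod c x0 by exact: coord_cod.
have [chi [chi1 _ schi]] := chart_bump Ac (@cod_open _ _ _ c) (@subset_refl _ _) cx0.
pose U : set 'rV[R]_n := cod c `&` [set x | chi x = 1]^°.
have oU : open U by apply: openI; [exact: cod_open|exact: open_interior].
have Uc : U `<=` cod c by move=> x [].
have Ux0 : U x0 by split.
have [phi [phi1 phiU sphi]] := chart_bump Ac oU Uc Ux0.
have s1 : smooth_on U (cst (1 : R) : 'rV[R]_n -> R) by move=> k; exact: Ck_cst.
pose phiM : Coo := mk_smooth (sphi _ s1).
pose f j : Coo := mk_smooth (schi _ (@smooth_on_coord R n j (cod c))).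
pose e j (g : Coo) := extend_by_zero c (phi * 'D_(delta_mx 0 j) (g \o param c)).
have de j q : derivation_at q (fun g => e j g q).
  rewrite /e; have [cq|ncq] := pselect (dom c q); last first.
    by split=> *; rewrite !extend_by_zero_out// ?(addr0, mulr0, mul0r).
  have dg (g : Coo) : differentiable (g \o param c) (coord c q).
    exact: smooth_on_differentiable (smooth_functionP g Ac) (coord_cod cq).
  have dv (g : Coo) : derivable (g \o param c) (coord c q) (delta_mx 0 j).
    exact: diff_derivable.
  split=> [g h|a g|g h]; rewrite !extend_by_zeroM_in//.
  - rewrite (_ : (g + h) \o param c = (g \o param c) + (h \o param c))//.
    by rewrite deriveD// mulrDr.
  - rewrite (_ : (_ * g) \o param c = a *: (g \o param c))//.
    by rewrite deriveZ// mulrCA.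
  - rewrite (_ : (g * h) \o param c = (g \o param c) * (h \o param c))//.
    rewrite deriveM//= coordK// /GRing.scale/=; ring.
have se j (g : Coo) : smooth (fun q => mk_tangent (de j q) g).
  have sg : smooth_on U (g \o param c).
    exact: smooth_on_subset Uc (smooth_functionP g Ac).
  exact: (sphi _ (smooth_on_derive _ sg)).
exists phiM, f, (fun j => VectorField (se j)); split.
  have := coord_continuous cp phi1; rewrite /=.
  move=> H; near=> q.
  have cq : dom c q.
    by near: q; exact: (open_nbhs_nbhs (conj (@dom_open _ _ _ c) cp)).
  rewrite /phiM/= extend_by_zeroM_in//= mulr1.
  by near: q.
move=> q v g; have [cq|ncq] := pselect (dom c q); last first.
  rewrite /= extend_by_zero_out// mul0r big1// => j _.
  by rewrite /e extend_by_zero_out// mulr0.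
rewrite [phiM q]extend_by_zeroM_in// mulr1.
under eq_bigr do rewrite /e /= extend_by_zeroM_in// mulrCA.
rewrite -mulr_sumr.
have [->|/phiU Uq] := eqVneq (phi (coord c q)) 0; first by rewrite !mul0r.
congr (_ * _); apply: (@tangent_expand c q v U f g) => //.
move=> j z cz [_ /interior_subset/= cz1].
by rewrite /= extend_by_zeroM_in// cz1 mul1r.
Unshelve. all: by end_near. Qed.

End Charts.

(** * Existence of an affine connection *)

Section Existence.
Variables (R : realType) (n : nat) (M : manifold R n).
Local Notation Coo := (smooth_function M).
Local Notation VF := (vector_field M).

Lemma smooth_local (f : M -> R) :
  (forall p : M, exists h : Coo, \forall q \near p, f q = h q) -> smooth f.
Proof.
move=> loc c Ac; apply: smooth_on_local => x cx.
have [h fh] := loc (param c x).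
have [A [oA Ap] Af] : exists2 A, open_nbhs (param c x) A & A `<=` [set q | f q = h q].
  by have : nbhs (param c x) [set q | f q = h q] := fh; rewrite nbhsE.
exists (cod c `&` param c @^-1` A); first by split.
apply: (@smooth_on_ext _ _ _ _ (h \o param c)).
- by apply: open_setI_preimage => //; [exact: cod_open|exact: param_continuous].
- by move=> z /set_mem[cz /Af/= ->].
- by apply: smooth_on_subset (smooth_functionP h Ac) => z [].
Qed.

Record local_frame_datum := LocalFrame {
  cutoff : Coo;
  fun_of : 'I_n -> Coo;
  vec_of : 'I_n -> VF;
  frame_expand : forall q (v : tangent q) g,
    cutoff q * v g = \sum_j v (fun_of j) * vec_of j q g }.

Fact trivial_frame_expand q (v : tangent q) g :
  (0 : Coo) q * v g = \sum_(j < n) v 0 * (0 : VF) q g.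
Proof.
rewrite big1 => [|j _]; first exact: mul0r.
by rewrite tangent0 mul0r.
Qed.

Definition trivial_frame : local_frame_datum :=
  LocalFrame (fun_of := fun=> 0) (vec_of := fun=> 0) trivial_frame_expand.

(** Every point lies in a set of a countable basis on which the cutoff of some
    local frame is 1, and one local frame is chosen for each such set. *)
Lemma countable_frames : exists d : nat -> local_frame_datum,
  forall p : M, exists k, \forall q \near p, cutoff (d k) q = 1.
Proof.
have [B /countable_injP[i injB] [Bop Bbas]] := @manifold_second_countable R n M.
pose good (S : set M) (d : local_frame_datum) := S `<=` [set q | cutoff d q = 1].
have /choice[d dP] (k : nat) : exists d, forall S, B S -> i S = k ->
    (exists d', good S d') -> good S d.
  (* Integers that do not number a suitable basic set get the trivial frame. *)
  have [[S [BS iS [d' Sd']]]|none] :=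
    pselect (exists S, [/\ B S, i S = k & exists d', good S d']).
    exists d' => S' BS' iS' _; have -> // : S' = S.
    by apply: injB; rewrite ?inE// iS.
  by exists trivial_frame => S BS iS ex; case: none; exists S.
exists d => p; have [phi [f [E [phi1 fE]]]] := local_frame p.
have [S [BS Sp] Sphi] := Bbas p _ phi1.
exists (i S); apply: filterS (open_nbhs_nbhs (conj (Bop _ BS) Sp)) => q Sq.
by apply: (dP (i S) S) => //; exists (LocalFrame fE) => z /Sphi.
Qed.

Section Glue.
Variable d : nat -> local_frame_datum.
Local Notation phi k := (cutoff (d k)).

(** Equal to [1 - sum_(i < k) phi i * remainder i]: the part of the constant
    function 1 that the first [k] terms of the partition of unity leave. *)
Definition remainder (k : nat) : Coo := \prod_(i < k) (1 - phi i).

(** A partial sum of the connection that is sought. Instead of a product rule it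
    satisfies [partial_nabla_leibniz], with the defect [remainder k]. *)
Definition partial_nabla (k : nat) (X Y : VF) : VF :=
  \sum_(i < k) remainder i *:
    \sum_j vf_app X (vf_app Y (fun_of (d i) j)) *: vec_of (d i) j.

Lemma remainderS k p : remainder k.+1 p = remainder k p * (1 - phi k p).
Proof. by rewrite /remainder big_ord_recr. Qed.

Lemma partial_nablaS k X Y p g : partial_nabla k.+1 X Y p g =
  partial_nabla k X Y p g + remainder k p *
    \sum_j X p (vf_app Y (fun_of (d k) j)) * vec_of (d k) j p g.
Proof.
rewrite /partial_nabla big_ord_recr vf_addE vf_scaleE; congr (_ + _ * _).
by rewrite vf_sumE; apply: eq_bigr => j _; rewrite vf_scaleE.
Qed.

Lemma partial_nabla0 X Y p g : partial_nabla 0 X Y p g = 0.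
Proof. by rewrite /partial_nabla big_ord0 vf_zeroE. Qed.

Lemma partial_nabla_linearl k (f : Coo) X Y Z p g :
  partial_nabla k (f *: X + Y) Z p g =
  f p * partial_nabla k X Z p g + partial_nabla k Y Z p g.
Proof.
elim: k => [|k IH]; first by rewrite !partial_nabla0 mulr0 addr0.
rewrite !partial_nablaS IH.
under eq_bigr do rewrite vf_addE vf_scaleE mulrDl -mulrA.
by rewrite big_split/= -mulr_sumr; ring.
Qed.

Lemma partial_nabla_addr k X Y Z p g : partial_nabla k X (Y + Z) p g =
  partial_nabla k X Y p g + partial_nabla k X Z p g.
Proof.
elim: k => [|k IH]; first by rewrite !partial_nabla0 addr0.
rewrite !partial_nablaS IH.
under eq_bigr do rewrite vf_app_add tangentD mulrDl.
by rewrite big_split/=; ring.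
Qed.

Lemma partial_nabla_leibniz k (h : Coo) X Y p g : partial_nabla k X (h *: Y) p g =
  (1 - remainder k p) * (X p h * Y p g) + h p * partial_nabla k X Y p g.
Proof.
elim: k => [|k IH].
  rewrite !partial_nabla0 (_ : remainder 0 p = 1); last by rewrite /remainder big_ord0.
  by rewrite subrr mul0r mulr0 addr0.
rewrite !partial_nablaS IH remainderS.
under eq_bigr do rewrite vf_app_scale tangentM mulrDl -!mulrA.
by rewrite big_split/= -!mulr_sumr -frame_expand; ring.
Qed.

Lemma remainder_eq0 k l p : phi k p = 1 -> (k < l)%N -> remainder l p = 0.
Proof.
move=> pk; elim: l => // l IH; rewrite ltnS leq_eqVlt remainderS.
by case/orP => [/eqP <-|/IH ->]; rewrite ?pk ?subrr ?mulr0 ?mul0r.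
Qed.

Lemma partial_nabla_stable k l X Y p g : phi k p = 1 -> (k < l)%N ->
  partial_nabla l X Y p g = partial_nabla k.+1 X Y p g.
Proof.
move=> pk; elim: l => // l IH; rewrite ltnS leq_eqVlt.
case/orP => [/eqP <-//|kl].
by rewrite partial_nablaS (remainder_eq0 pk kl) mul0r addr0 IH.
Qed.

Variable level : M -> nat.
Hypothesis level_cutoff : forall p : M, \forall q \near p, phi (level p) q = 1.

(** Near [p] the value at [q] is computed by the partial sum at [level q], but it
    equals the one at [level p], since both partial sums have stabilised at
    [q]. *)
Lemma glued_nabla_smooth X Y (g : Coo) :
  smooth (fun p => partial_nabla (level p).+1 X Y p g).
Proof.
apply: smooth_local => p.
exists (vf_app (partial_nabla (level p).+1 X Y) g).
near=> q => /=.
have q1 : phi (level p) q = 1 by near: q; exact: level_cutoff.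
have q2 : phi (level q) q = 1 by exact: (nbhs_singleton (level_cutoff q)).
pose l := (maxn (level p) (level q)).+1.
rewrite -(partial_nabla_stable (l := l) _ _ _ q1) ?ltnS ?leq_maxl//.
by rewrite -(partial_nabla_stable (l := l) _ _ _ q2) ?ltnS ?leq_maxr.
Unshelve. all: by end_near. Qed.

Definition glued_nabla (X Y : VF) : VF := VectorField (glued_nabla_smooth X Y).

Lemma glued_connection : inhabited (affine_connection M).
Proof.
constructor; apply: (@AffineConnection _ _ _ glued_nabla).
- move=> f X Y Z; apply: vector_fieldP => p g; rewrite !vfE /=.
  exact: partial_nabla_linearl.
- move=> X Y Z; apply: vector_fieldP => p g; rewrite !vfE /=.
  exact: partial_nabla_addr.
- move=> h X Y; apply: vector_fieldP => p g; rewrite !vfE /=.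
  have p1 : phi (level p) p = 1 by exact: (nbhs_singleton (level_cutoff p)).
  by rewrite partial_nabla_leibniz (remainder_eq0 p1)// subr0 mul1r.
Qed.

End Glue.

Theorem inhabited_affine_connection : inhabited (affine_connection M).
Proof.
have [d dP] := countable_frames.
have /choice[level levelP] := dP.
exact: glued_connection levelP.
Qed.

End Existence.

(** * Torsion and complex structures *)

Section Algebra.
Variables (R : realType) (n : nat) (M : manifold R n).
Local Notation Coo := (smooth_function M).
Local Notation VF := (vector_field M).

Lemma lie_bracketDr (X Y Z : VF) :
  lie_bracket X (Y + Z) = lie_bracket X Y + lie_bracket X Z.
Proof.
apply: vector_fieldP => p f.
by rewrite !(vfE, lie_bracketE) vf_app_add tangentD; ring.
Qed.

Lemma lie_bracketZr (h : Coo) (X Y : VF) :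
  lie_bracket X (h *: Y) = vf_app X h *: Y + h *: lie_bracket X Y.
Proof.
apply: vector_fieldP => p f.
by rewrite !(vfE, lie_bracketE) vf_app_scale tangentM /=; ring.
Qed.

Lemma lie_bracketC (X Y : VF) : lie_bracket Y X = - lie_bracket X Y.
Proof. by apply: vector_fieldP => p f; rewrite !(vfE, lie_bracketE); ring. Qed.

Lemma lie_bracketNr (X Y : VF) : lie_bracket X (- Y) = - lie_bracket X Y.
Proof.
have lie0 : lie_bracket X 0 = 0.
  by apply: (addrI (lie_bracket X 0)); rewrite -lie_bracketDr !addr0.
by apply: (addrI (lie_bracket X Y)); rewrite -lie_bracketDr !subrr lie0.
Qed.

Section Connection.
Variable D : affine_connection M.

Lemma nablaDl X Y Z : D (X + Y) Z = D X Z + D Y Z.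
Proof. by rewrite -[X]scale1r nabla_linearl !scale1r. Qed.

Lemma nabla0l Z : D 0 Z = 0.
Proof. by apply: (addrI (D 0 Z)); rewrite -nablaDl !addr0. Qed.

Lemma nablaZl h X Z : D (h *: X) Z = h *: D X Z.
Proof. by rewrite -[h *: X]addr0 nabla_linearl nabla0l addr0. Qed.

Lemma nablaNl X Z : D (- X) Z = - D X Z.
Proof. by rewrite -scaleN1r nablaZl scaleN1r. Qed.

Lemma nabla0r X : D X 0 = 0.
Proof. by apply: (addrI (D X 0)); rewrite -nabla_addr !addr0. Qed.

Lemma nablaNr X Z : D X (- Z) = - D X Z.
Proof.
by apply: (addrI (D X Z)); rewrite -nabla_addr !subrr nabla0r.
Qed.

(** Equal to [D X Y - torsion D X Y / 2]. *)
Definition sym_nabla (X Y : VF) : VF :=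
  smooth_const M 2^-1 *: (D X Y + D Y X + lie_bracket X Y).

Lemma sym_nabla_addr X Y Z : sym_nabla X (Y + Z) = sym_nabla X Y + sym_nabla X Z.
Proof.
rewrite /sym_nabla nabla_addr nablaDl lie_bracketDr.
by apply: vector_fieldP => p f; rewrite !vfE; ring.
Qed.

Lemma sym_nabla_leibniz f X Y :
  sym_nabla X (f *: Y) = vf_app X f *: Y + f *: sym_nabla X Y.
Proof.
rewrite /sym_nabla nabla_leibniz nablaZl lie_bracketZr.
by apply: vector_fieldP => p g; rewrite !vfE /=; field.
Qed.

Lemma sym_nabla_linearl f X Y Z :
  sym_nabla (f *: X + Y) Z = f *: sym_nabla X Z + sym_nabla Y Z.
Proof.
rewrite /sym_nabla nabla_linearl nabla_addr nabla_leibniz.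
rewrite (lie_bracketC Z (_ + _)) lie_bracketDr lie_bracketZr.
rewrite (lie_bracketC Z X) (lie_bracketC Z Y).
by apply: vector_fieldP => p g; rewrite !vfE /=; ring.
Qed.

Definition sym_connection :=
  AffineConnection sym_nabla_linearl sym_nabla_addr sym_nabla_leibniz.

Lemma sym_connection_torsion X Y : torsion sym_connection X Y = 0.
Proof.
rewrite /torsion/= /sym_nabla (lie_bracketC X Y).
by apply: vector_fieldP => p g; rewrite !vfE /=; field.
Qed.

End Connection.

Section ComplexStructure.
Variable J : almost_complex_structure M.
Local Notation j := (acs_app J).

Lemma acs_appD X Y : j (X + Y) = j X + j Y.
Proof.
apply: vector_fieldP => p f; rewrite vf_addE /=.
by rewrite -tangentDE linearD.
Qed.

Lemma acs_appZ h X : j (h *: X) = h *: j X.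
Proof.
apply: vector_fieldP => p f; rewrite vf_scaleE /=.
by rewrite -tangentZE linearZ.
Qed.

Lemma acs_appN X : j (- X) = - j X.
Proof. by rewrite -scaleN1r acs_appZ scaleN1r. Qed.

Lemma acs_appK X : j (j X) = - X.
Proof. by apply: vector_fieldP => p f; rewrite vf_oppE /= acs_sqr tangentNE. Qed.

Definition jE := (acs_appD, acs_appN, acs_appZ, acs_appK).

Lemma torsionC (D : affine_connection M) X Y : torsion D Y X = - torsion D X Y.
Proof.
rewrite /torsion (lie_bracketC X Y).
by apply: vector_fieldP => p f; rewrite !vfE; ring.
Qed.

Lemma torsionNl (D : affine_connection M) X Y : torsion D (- X) Y = - torsion D X Y.
Proof.
rewrite /torsion nablaNl nablaNr (lie_bracketC Y (- X)) lie_bracketNr.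
rewrite (lie_bracketC X Y).
by apply: vector_fieldP => p f; rewrite !vfE; ring.
Qed.

(** Replace each bracket by [D X Y - D Y X - torsion D X Y]; as [D] commutes with
    [J], the derivatives cancel in pairs. *)
Lemma nijenhuis_torsion (D : affine_connection M) X Y : complex_connection J D ->
  nijenhuis J X Y = torsion D X Y + j (torsion D X (j Y)) + j (torsion D (j X) Y)
    - torsion D (j X) (j Y).
Proof.
move=> cD; rewrite /nijenhuis /torsion !cD !jE.
by apply: vector_fieldP => p f; rewrite !vfE; ring.
Qed.

(** Equal to [D X Y - Q X Y], where, writing [D_X J] for the covariant derivative of
    [J] along [X],
      [4 Q X Y = (D_(JY) J) X + J (D_Y J) X + 2 J (D_X J) Y].
    The last term makes the connection complex, and the first two are compatible
    with [J] in the argument [Y]. For [D] without torsion, [Q X Y - Q Y X] is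
    minus a quarter of the Nijenhuis tensor. *)
Definition complex_nabla (D : affine_connection M) (X Y : VF) : VF :=
  smooth_const M 4^-1 *:
    (D X Y + D X Y - j (D X (j Y)) - j (D X (j Y)) - D (j Y) (j X)
     + j (D (j Y) X) - j (D Y (j X)) - D Y X).

Variable D : affine_connection M.

Lemma complex_nabla_addr X Y Z :
  complex_nabla D X (Y + Z) = complex_nabla D X Y + complex_nabla D X Z.
Proof.
rewrite /complex_nabla !jE !nabla_addr !nablaDl !jE.
by apply: vector_fieldP => p f; rewrite !vfE; ring.
Qed.

Lemma complex_nabla_leibniz f X Y :
  complex_nabla D X (f *: Y) = vf_app X f *: Y + f *: complex_nabla D X Y.
Proof.
rewrite /complex_nabla !jE !nabla_leibniz !nablaZl !jE.
by apply: vector_fieldP => p g; rewrite !vfE /=; field.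
Qed.

Lemma complex_nabla_linearl f X Y Z :
  complex_nabla D (f *: X + Y) Z = f *: complex_nabla D X Z + complex_nabla D Y Z.
Proof.
rewrite /complex_nabla !jE !nabla_linearl !nabla_addr !nabla_leibniz !jE.
by apply: vector_fieldP => p g; rewrite !vfE /=; ring.
Qed.

Definition complex_connection_of :=
  AffineConnection complex_nabla_linearl complex_nabla_addr complex_nabla_leibniz.

Lemma complex_connection_of_complex : complex_connection J complex_connection_of.
Proof.
move=> X Y; rewrite /= /complex_nabla !jE !nablaNl !nablaNr !jE.
by apply: vector_fieldP => p g; rewrite !vfE /=; ring.
Qed.

Lemma complex_connection_of_torsion : (forall X Y, torsion D X Y = 0) ->
  forall X Y, torsion complex_connection_of X Y =
    smooth_const M 4^-1 *: nijenhuis J X Y.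
Proof.
move=> T0 X Y; rewrite /torsion/= /complex_nabla.
have LE A B : lie_bracket A B = D A B - D B A.
  by apply/esym/eqP; rewrite -subr_eq0 -[_ - _]/(torsion D A B) T0.
rewrite /nijenhuis !LE !jE.
by apply: vector_fieldP => p g; rewrite !vfE /=; field.
Qed.

End ComplexStructure.
End Algebra.

Theorem proposition2p2 (R : realType) (n : nat) (M : manifold R n)
    (J : almost_complex_structure M) :
  (forall D : affine_connection M,
     complex_connection J D -> torsion_type_11 J D -> integrable J) /\
  (forall D : affine_connection M,
     complex_connection J D -> torsion_type_20 J D -> integrable J) /\
  (forall D : affine_connection M,
     complex_connection J D -> torsion_type_20_02 J D -> integrable J ->
     torsion_type_20 J D) /\
  (integrable J ->
     exists D : affine_connection M, complex_connection J D /\ torsion_type_11 J D) /\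
  (integrable J ->
     exists D : affine_connection M, complex_connection J D /\ torsion_type_20 J D).
Proof.
have torsion_free_complex : integrable J -> exists D : affine_connection M,
    complex_connection J D /\ forall X Y, torsion D X Y = 0.
  move=> intJ; have [D] := inhabited_affine_connection M.
  exists (complex_connection_of J (sym_connection D)); split.
    exact: complex_connection_of_complex.
  move=> X Y; rewrite complex_connection_of_torsion ?intJ ?scaler0//.
  exact: sym_connection_torsion.
split; [|split; [|split; [|split]]].
- move=> D cD tD X Y; rewrite (nijenhuis_torsion _ _ cD) tD.
  have -> : torsion D X (acs_app J Y) = - torsion D (acs_app J X) Y.
    by rewrite -(tD (acs_app J X) Y) acs_appK torsionNl opprK.
  rewrite acs_appN; apply: vector_fieldP => p f; rewrite !vfE; ring.
- move=> D cD tD X Y; rewrite (nijenhuis_torsion _ _ cD).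
  have tD' A B : torsion D A (acs_app J B) = acs_app J (torsion D A B).
    by rewrite torsionC tD (torsionC D A B) acs_appN opprK.
  rewrite !tD !tD' !jE.
  by apply: vector_fieldP => p f; rewrite !vfE; ring.
- move=> D cD tD intJ X Y; have := intJ X Y.
  rewrite (nijenhuis_torsion _ _ cD) tD.
  have -> : torsion D X (acs_app J Y) = torsion D (acs_app J X) Y.
    by apply: oppr_inj; rewrite -(tD (acs_app J X) Y) acs_appK torsionNl.
  set T := torsion D X Y; set S := torsion D (acs_app J X) Y => T0.
  have jT : acs_app J S = - T.
    apply: vector_fieldP => p f.
    have : (T + acs_app J S + acs_app J S - - T) p f = (0 : vector_field M) p f.
      by rewrite T0.
    by rewrite !vfE; lra.
  by apply: oppr_inj; rewrite -(acs_appK J) jT acs_appN.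
- move=> /torsion_free_complex[D [cD D0]]; exists D; split=> // X Y.
  by rewrite !D0.
- move=> /torsion_free_complex[D [cD D0]]; exists D; split=> // X Y.
  by rewrite !D0; have := acs_appZ J 0 0; rewrite !scale0r.
Qed.
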